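(* Let $\mathcal T$ be a locally finite normal tiling of $\mathbb E^d$ by convex $d$-polytopes and let $s$ be a canonical scaling of $\mathcal T$. Then the generatrix $\mathcal G_{\mathcal T}=\mathcal G(\mathcal T,s)\subset\mathbb E^{d+1}$ constructed from $s$ is the graph of a convex continuous piecewise linear function $G:\mathbb E^d\to\mathbb R$, and accordingly it is the boundary of a convex $(d+1)$-dimensional polyhedron.
   Context: Normal (face-to-face) means: the intersection of any two cells is either empty or a common face of both. Two cells are adjacent if they share a $(d-1)$-face (hyperface). A chain of cells is a finite sequence of cells in which consecutive cells are adjacent. Canonical scaling. Let $\mathcal F^{d-1}$ be the set of hyperfaces of $\mathcal T$ and $s:\mathcal F^{d-1}\to\mathbb R_+$ a positive function (a scaling). For a $(d-2)$-face $F$ of $\mathcal T$, take all hyperfaces $F_i$ containing $F$ in cyclic order around $F$, and let $\mathbf n_i$ be the unit normal to $F_i$ pointing in the chosen direction of going around $F$. Put $\Delta_s(F)=\sum_i s(F_i)\mathbf n_i$ (sum over all hyperfaces containing $F$). The scaling $s$ is canonical if $\Delta_s(F)=0$ for every $(d-2)$-face $F$. Construction of $\mathcal G(\mathcal T,s)$. $\mathbb E^d$ is embedded in $\mathbb E^{d+1}$ as $\{x_{d+1}=0\}$; $\mathbf n_0=(0,\dots,0,-1)$. A lift of a $d$-polytope $Q\subset\mathbb E^d$ is a $d$-polytope in $\mathbb E^{d+1}$, not parallel to $\mathbf n_0$, whose orthogonal projection to $\mathbb E^d$ is $Q$. For adjacent $Q_1,Q_2$, a lift $\widetilde Q_1$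 of $Q_1$ with normal vector $\mathbf n_1$ and a nonzero $\mathbf n\in\mathbb E^d$ normal to $Q_1\cap Q_2$, the lift of $Q_2$ up to $\widetilde Q_1$ with normal increment $\mathbf n$ is the unique lift $\widetilde Q_2$ of $Q_2$ with normal vector $\mathbf n_1+\mathbf n$ such that $\widetilde Q_1\cap\widetilde Q_2$ is a face of both and projects onto $Q_1\cap Q_2$. Fix an initial cell $P_0$; for adjacent cells $P_i,P_j$ let $\mathbf n_{i,j}$ be the unit normal to $P_i\cap P_j$ directed from $P_i$ to $P_j$. For each chain $[P_0,P_1,\dots,P_k]$ define $L[P_0]=P_0$ with normal $\mathbf n_0$, and $L[P_0,\dots,P_k]$ as the lift of $P_k$ up to $L[P_0,\dots,P_{k-1}]$ with normal increment $s(P_{k-1}\cap P_k)\,\mathbf n_{k-1,k}$. The $d$-faces of $\mathcal G(\mathcal T,s)$ are all these polytopes. For canonical $s$ this surface is a generatrix of $\mathcal T$: a $d$-dimensional polyhedral manifold whose orthogonal projection to $\mathbb E^d$ is one-to-one and coincides with $\mathcal T$; hence it is the graph of a function $G:\mathbb E^d\to\mathbb R$. *)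

(* Defs.v *)
(* The Euclidean space E^d is 'rV[R]_d, with R : realType. *)
From mathcomp Require Import all_boot all_order all_algebra.
From mathcomp Require Import all_classical all_reals all_analysis.

Set Implicit Arguments.
Unset Strict Implicit.
Unset Printing Implicit Defensive.

Import Order.TTheory GRing.Theory Num.Theory.
Import numFieldNormedType.Exports.

Local Open Scope classical_set_scope.
Local Open Scope ring_scope.

Section EuclideanGeometry.
Variables (R : realType) (n : nat).
Local Notation E := 'rV[R]_n.
Implicit Types (A P F K : set E) (V W : {vspace E}) (a u : E).

Definition dot (x y : E) : R := \sum_(i < n) x 0 i * y 0 i.

Definition is_convex A : Prop := convex_set (A : set (convex_lmodType E)).

Definition convex_hull A : set E :=
  \bigcap_(C in [set C | is_convex C /\ A `<=` C]) C.

Definition polytope P : Prop := exists s : seq E, P = convex_hull [set` s].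

(* V is the direction of the affine hull of A. *)
Definition is_direction A V : Prop :=
  (forall x y, A x -> A y -> x - y \in V) /\
  (forall W, (forall x y, A x -> A y -> x - y \in W) -> (V <= W)%VS).

(* The empty set has no dimension here, so a "k-face" below is nonempty. *)
Definition has_dim A (k : nat) : Prop :=
  A !=set0 /\ exists2 V, is_direction A V & \dim V = k.

(* a = 0 is allowed: the empty set and P itself are (improper) faces. *)
Definition is_face F P : Prop :=
  exists (a : E) (b : R),
    (forall x, P x -> dot a x <= b) /\ F = P `&` [set x | dot a x = b].

Definition normal_to u A : Prop := forall x y, A x -> A y -> dot u (x - y) = 0.

Definition unit_normal u A : Prop := dot u u = 1 /\ normal_to u A.

Definition boundary A : set E := closure A `\` interior A.

(* Infinitely many facets are allowed, but only locally finitely many. *)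
Definition convex_polyhedron K : Prop :=
  [/\ is_convex K, closed K &
      forall x : E, exists hs : seq (E * R),
        \forall y \near x, K y <-> forall h, h \in hs -> dot h.1 y <= h.2].

End EuclideanGeometry.

Section Tilings.
Variables (R : realType) (d : nat).
Local Notation E := 'rV[R]_d.
Implicit Types (T : set (set E)) (P Q F H : set E) (s : set E -> R) (u v : E).

Definition locally_finite T : Prop :=
  forall x : E, exists2 U, nbhs x U & finite_set [set P | T P /\ P `&` U !=set0].

Definition polytope_tiling T : Prop :=
  [/\ forall P, T P -> polytope P /\ has_dim P d,
      \bigcup_(P in T) P = setT &
      forall P Q, T P -> T Q -> P <> Q -> interior P `&` interior Q = set0].

Definition face_to_face T : Prop :=
  forall P Q, T P -> T Q ->
    P `&` Q = set0 \/ is_face (P `&` Q) P /\ is_face (P `&` Q) Q.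

Definition locally_finite_normal_tiling T : Prop :=
  [/\ polytope_tiling T, locally_finite T & face_to_face T].

(* F is a (d - j)-face of the tiling, without truncated subtraction: for
   d < j there is none. *)
Definition codim_face T (j : nat) F : Prop :=
  exists P k, [/\ T P, is_face F P, has_dim F k & (k + j = d)%N].

Definition hyperface T : set (set E) := [set H | codim_face T 1 H].

Definition adjacent_cells P Q : Prop :=
  P <> Q /\
  exists H k, [/\ is_face H P, is_face H Q, has_dim H k & (k + 1 = d)%N].

Definition scaling T s : Prop := forall H, hyperface T H -> 0 < s H.

(* (u, v) is an orthonormal basis of the plane orthogonal to the (d-2)-face F;
   its orientation is a direction of going around F. *)
Definition normal_frame F u v : Prop :=
  [/\ unit_normal u F, unit_normal v F & dot u v = 0].

(* The unit normal to the hyperface H, which contains F, in the direction of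
   going around F from u to v: seen in the plane of (u, v), the hyperface H is
   a ray from the origin, and the normal is this ray turned counterclockwise by
   a right angle.  It exists and is unique whenever F is a (d-2)-face of H. *)
Definition turning_normal u v F H : E :=
  xget 0 [set n | unit_normal n H /\
    forall p x, F p -> H x -> ~ F x ->
      0 < dot u (x - p) * dot v n - dot v (x - p) * dot u n].

(* The support of the sum is the set of all hyperfaces containing F, which is
   finite when T is locally finite. *)
Definition Delta T s u v F : E :=
  \sum_(H \in [set H | hyperface T H /\ F `<=` H]) s H *: turning_normal u v F H.

Definition canonical_scaling T s : Prop :=
  scaling T s /\
  forall F u v, codim_face T 2 F -> normal_frame F u v -> Delta T s u v F = 0.

End Tilings.

Section Generatrix.
Variables (R : realType) (d : nat).
Local Notation E := 'rV[R]_d.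
Local Notation E1 := 'rV[R]_(d + 1).
Implicit Types (T : set (set E)) (P Q : set E) (s : set E -> R) (u n : E).
Implicit Types (Pt Qt : set E1) (nt : E1).

Definition lift_pt (x : E) (t : R) : E1 := row_mx x t%:M.

Definition embed (x : E) : E1 := lift_pt x 0.

Definition orth_proj (z : E1) : E := lsubmx z.

Definition n0 : E1 := lift_pt 0 (- 1).

Definition is_lift Q Qt : Prop :=
  [/\ polytope Qt, has_dim Qt d,
      forall V, is_direction Qt V -> n0 \notin V &
      orth_proj @` Qt = Q].

(* Qt2 is the lift of Q2 up to the lift Qt1 (with normal vector nt1) of Q1,
   with normal increment n. *)
Definition is_lift_up Q1 Q2 Qt1 nt1 n Qt2 : Prop :=
  [/\ is_lift Q2 Qt2, normal_to (nt1 + embed n) Qt2,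
      is_face (Qt1 `&` Qt2) Qt1, is_face (Qt1 `&` Qt2) Qt2 &
      orth_proj @` (Qt1 `&` Qt2) = Q1 `&` Q2].

Definition directed_normal P Q u : Prop :=
  unit_normal u (P `&` Q) /\
  forall p, (P `&` Q) p ->
    (forall x, P x -> dot u (x - p) <= 0) /\
    (forall y, Q y -> 0 <= dot u (y - p)).

(* chain_lift T s P0 c Qt nt: the sequence c is a chain of cells that starts at
   P0, and Qt = L[c] with normal vector nt. *)
Inductive chain_lift T s P0 : seq (set E) -> set E1 -> E1 -> Prop :=
| chain_lift_init : chain_lift T s P0 [:: P0] (embed @` P0) n0
| chain_lift_step c P Q Pt nt u Qt :
    chain_lift T s P0 (rcons c P) Pt nt ->
    T Q -> adjacent_cells P Q -> directed_normal P Q u ->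
    is_lift_up P Q Pt nt (s (P `&` Q) *: u) Qt ->
    chain_lift T s P0 (rcons (rcons c P) Q) Qt (nt + embed (s (P `&` Q) *: u)).

(* The surface G(T, s), as the union of its d-faces. *)
Definition generatrix T s P0 : set E1 :=
  \bigcup_(Qt in [set Qt | exists c nt, chain_lift T s P0 c Qt nt]) Qt.

Definition graph (G : E -> R) : set E1 := [set lift_pt x (G x) | x in setT].

Definition is_convex_function (G : E -> R) : Prop :=
  convex_function (setT : set (convex_lmodType E)) (G : convex_lmodType E -> R^o).

Definition piecewise_linear_on T (G : E -> R) : Prop :=
  forall P, T P -> exists (a : E) (b : R), forall x, P x -> G x = dot a x + b.

End Generatrix.

(* Main.v *)
Require Import Defs.
From HB Require Import structures.
From mathcomp Require Import all_boot all_order all_algebra.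
From mathcomp Require Import all_classical all_reals all_analysis.
From mathcomp Require Import finmap lra ring zify.

(** The surface is encoded by one affine function for each cell.  A family l of
    affine functions is consistent if, whenever P and Q share a facet with unit
    normal u from P to Q, the difference of l Q and l P vanishes on the facet
    and has gradient s (P `&` Q) *: u.  Suppose that a consistent family with
    l P0 = 0 is given.

    - The lift along a chain is determined at each step by its normal vector
      and one of its points, so it is the part of the graph of l Q over the last
      cell Q (chain_lift_over), and every cell is the end of a chain
      (chain_exists).  The affine functions agree where cells meet
      (values_agree), so the generatrix is the graph of one function G.
    - Let a generic segment run towards x.  At each facet that it crosses, the
      value at x of the current affine function cannot decrease, because s is
      positive.  So the function of the cell of x has the largest value at x
      among all cells (value_max), and G is a maximum of affine functions, hence
      convex.  Its epigraph is the polyhedron whose boundary is the generatrix.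

    The existence of the family (global_family) says that the jumps have no
    monodromy.  The carrier of a point x is the intersection of all cells
    through x; it contains x in its relative interior (carrier_relint), and the
    codimension of x is the codimension of its carrier.  Three facts are
    combined.

    - Near a point z of codimension at most two there is a consistent family
      (trivial_codim2).  Around a face of codimension two the facets are rays in
      the normal plane.  Fix a base vector w and give to a cell the sum of
      s H *: n_H over the rays H crossed, with sign, on the way from w to a
      point of the cell.  A closed triangle crosses all rays equally often
      (crossing_sum), so around it the sum is a multiple of Delta, which
      vanishes because s is canonical.
    - Consistent families on two overlapping pieces of a convex region differ by
      a constant there, because a generic segment connects any two cells through
      facets (cells_connected); so they can be glued (glue).
    - By a count of dimensions, generic segments meet only points of codimension
      at most one and generic triangles only points of codimension at most two
      (generic_thin).  With a compactness argument (cousin), gluing gives a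
      consistent family around every generic segment and triangle
      (trivial_segment, trivial_triangle).

    The family on Q is then transported from P0 along a generic segment, and
    generic triangles with apex in P0 show that the result depends on the cell
    only and jumps correctly at the facets. *)

Set Implicit Arguments.
Unset Strict Implicit.
Unset Printing Implicit Defensive.

Import Order.TTheory GRing.Theory Num.Theory.
Import numFieldNormedType.Exports.

Local Open Scope classical_set_scope.
Local Open Scope ring_scope.

(** * Dot product and subspaces *)

Section DotProduct.
Variables (R : realType) (n : nat).
Local Notation E := 'rV[R]_n.
Implicit Types (x y z a u v w : E) (V W : {vspace E}).

Lemma dotC x y : dot x y = dot y x.
Proof. by apply: eq_bigr => i _; rewrite mulrC. Qed.

Lemma dotDr x y z : dot x (y + z) = dot x y + dot x z.
Proof. by rewrite -big_split; apply: eq_bigr => i _; rewrite mxE mulrDr. Qed.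

Lemma dotZr x y (k : R) : dot x (k *: y) = k * dot x y.
Proof. by rewrite mulr_sumr; apply: eq_bigr => i _; rewrite mxE mulrCA. Qed.

Lemma dotDl x y z : dot (x + y) z = dot x z + dot y z.
Proof. by rewrite !(dotC _ z) dotDr. Qed.

Lemma dotZl x y (k : R) : dot (k *: x) y = k * dot x y.
Proof. by rewrite !(dotC _ y) dotZr. Qed.

Lemma dotNr x y : dot x (- y) = - dot x y.
Proof. by rewrite -scaleN1r dotZr mulN1r. Qed.

Lemma dotNl x y : dot (- x) y = - dot x y.
Proof. by rewrite !(dotC _ y) dotNr. Qed.

Lemma dotBr x y z : dot x (y - z) = dot x y - dot x z.
Proof. by rewrite dotDr dotNr. Qed.

Lemma dotBl x y z : dot (x - y) z = dot x z - dot y z.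
Proof. by rewrite dotDl dotNl. Qed.

Lemma dot0r x : dot x 0 = 0.
Proof. by rewrite -(scale0r 0) dotZr mul0r. Qed.

Lemma dot0l x : dot 0 x = 0.
Proof. by rewrite dotC dot0r. Qed.

Definition dotE := (dotDr, dotDl, dotBr, dotBl, dotZr, dotZl, dotNr, dotNl,
  dot0r, dot0l).

Lemma dotxx_ge0 x : 0 <= dot x x.
Proof. by apply: sumr_ge0 => i _; rewrite -expr2 sqr_ge0. Qed.

Lemma dotxx_eq0 x : dot x x = 0 -> x = 0.
Proof.
move/eqP; rewrite psumr_eq0 => [|i _]; last by rewrite -expr2 sqr_ge0.
move/allP => x0; apply/rowP => i; rewrite mxE.
by have := x0 i (mem_index_enum _); rewrite /= -expr2 sqrf_eq0 => /eqP.
Qed.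

Lemma dotxx_gt0 x : x != 0 -> 0 < dot x x.
Proof.
move=> x0; rewrite lt_neqAle dotxx_ge0 andbT eq_sym.
by apply: contra_neq x0; exact: dotxx_eq0.
Qed.

Lemma coord_le_norm x i : `|x 0 i| <= `|x|.
Proof.
rewrite [leRHS]mx_normrE.
exact: (@le_bigmax_cond _ _ _ _ (0, i) xpredT (fun i : 'I_1 * 'I_n => `|x i.1 i.2|)).
Qed.

Lemma dot_bound a : exists2 C : R, 0 < C & forall x, `|dot a x| <= C * `|x|.
Proof.
exists (1 + \sum_i `|a 0 i|).
  by rewrite ltr_pwDl// sumr_ge0.
move=> x; rewrite mulrDl mul1r (le_trans (ler_norm_sum _ _ _))//.
rewrite ler_wpDl// mulr_suml ler_sum// => i _.
by rewrite normrM ler_wpM2l// coord_le_norm.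
Qed.

Lemma dot_bound_fin (I : finType) (a : I -> E) :
  exists2 C : R, 0 < C & forall i x, `|dot (a i) x| <= C * `|x|.
Proof.
have /choice[C aC] : forall i, exists C : R,
    0 < C /\ forall x, `|dot (a i) x| <= C * `|x|.
  by move=> i; have [C] := dot_bound (a i); exists C.
exists (1 + \sum_i `|C i|) => [|i x]; first by rewrite ltr_pwDl// sumr_ge0.
have [C0 /(_ x)/le_trans] := aC i; apply; rewrite ler_wpM2r//.
by rewrite (bigD1 i)//= addrCA ler_wpDr ?addr_ge0 ?sumr_ge0// ler_norm.
Qed.

Lemma nbhs_shiftP x (A : set E) :
  nbhs x A <-> exists2 e : R, 0 < e & forall w, `|w| < e -> A (x + w).
Proof.
have ballE (y z : E) (e : R) : ball y e z = (`|y - z| < e) by rewrite mx_norm_ball.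
split=> [/nbhs_ballP[e e0 eA]|[e e0 eA]].
  by exists e => // w we; apply: eA; rewrite ballE opprD addrA subrr add0r normrN.
apply/nbhs_ballP; exists e => // y; rewrite ballE => xy.
by rewrite -(subrK x y) addrC; apply: eA; rewrite distrC.
Qed.

Lemma dot_continuous a : continuous (dot a : E -> R).
Proof.
move=> x A /nbhs_ballP[e e0 eA]; have [C C0 aC] := dot_bound a.
change (nbhs x (dot a @^-1` A)).
apply/nbhs_shiftP; exists (e / C); first exact: divr_gt0.
move=> w we; apply: eA; rewrite /ball/= dotDr opprD addrA subrr add0r normrN.
by rewrite (le_lt_trans (aC _))// mulrC -ltr_pdivlMr.
Qed.

(** The rows of a basis of V span fewer than n dimensions, so that their
    transpose has a nonzero kernel. *)
Lemma proper_vspace_normal V : (\dim V < n)%N ->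
  exists2 a, a != 0 & forall x, x \in V -> dot a x = 0.
Proof.
move=> Vn; pose M := \matrix_(i < \dim V) (vbasis V)`_i.
have : kermx M^T != 0.
  by rewrite -mxrank_eq0 mxrank_ker mxrank_tr -lt0n subn_gt0 (leq_ltn_trans _ Vn)// rank_leq_row.
move/rowV0Pn => [a aK a0]; exists a => // x xV.
have aM (i : 'I_(\dim V)) : dot a (vbasis V)`_i = 0.
  move: aK => /sub_kermxP.
  move=> /matrixP/(_ 0 i); rewrite !mxE => <-.
  by apply: eq_bigr => j _; rewrite !mxE.
rewrite (coord_vbasis xV).
elim/big_ind : _ => [|y z y0 z0|i _]; rewrite ?dotE ?y0 ?z0 ?addr0//.
by rewrite aM mulr0.
Qed.

Lemma unit_vector a : a != 0 -> exists2 k : R, 0 < k & dot (k *: a) (k *: a) = 1.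
Proof.
move=> /dotxx_gt0 a0; exists (Num.sqrt (dot a a))^-1.
  by rewrite invr_gt0 sqrtr_gt0.
rewrite dotZl dotZr mulrA -invfM -expr2 sqr_sqrtr ?ltW// mulVf//.
by rewrite gt_eqF.
Qed.

Lemma proper_vspace_unit_normal V : (\dim V < n)%N ->
  exists2 u, dot u u = 1 & forall x, x \in V -> dot u x = 0.
Proof.
move=> /proper_vspace_normal[a a0 aV]; have [k _ k1] := unit_vector a0.
by exists (k *: a) => // x xV; rewrite dotZl aV// mulr0.
Qed.

Lemma dim_addv_line V x : x \notin V -> \dim (V + <[x]>) = (\dim V).+1.
Proof.
move=> xV; have x0 : x != 0 by apply: contraNneq xV => ->; rewrite mem0v.
rewrite dimv_disjoint_sum ?dim_vline ?x0 ?addn1//.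
apply/eqP; rewrite -subv0; apply/subvP => y; rewrite memv_cap => /andP[yV].
move/vlineP => [k yk]; rewrite memv0; move: yV; rewrite yk.
have [->|k0] := eqVneq k 0; first by rewrite scale0r.
by rewrite rpredZeq (negPf k0) (negPf xV).
Qed.

Lemma dim_rV : \dim {:E} = n.
Proof. by rewrite dimvf /dim /= mul1n. Qed.

Lemma mem_dim_full V x : \dim V = n -> x \in V.
Proof.
move=> Vn; have /eqP -> : V == fullv; last exact: memvf.
by rewrite -(geq_leqif (dimv_leqif_eq (subvf V))) dim_rV Vn.
Qed.

Lemma dim_leq V : (\dim V <= n)%N.
Proof. by have := dimvS (subvf V); rewrite dim_rV. Qed.

(** Otherwise V and x would span the whole space, and u would be orthogonal to
    itself. *)
Lemma hyperplane_mem V u x : (n <= (\dim V).+1)%N -> u != 0 ->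
  (forall y, y \in V -> dot u y = 0) -> dot u x = 0 -> x \in V.
Proof.
move=> Vn u0 uV ux; apply/negPn/negP => xV.
have := dim_addv_line xV => dimW.
have : u \in (V + <[x]>)%VS.
  by apply: mem_dim_full; apply/eqP; rewrite eqn_leq dim_leq dimW.
case/memv_addP => y yV [_ /vlineP[k ->] uE].
move/negP : u0; apply; apply/eqP/dotxx_eq0.
by rewrite {2}uE dotE uV// dotZr ux mulr0 addr0.
Qed.

Lemma codim2_mem V u v x : (n <= (\dim V).+2)%N ->
  dot u u = 1 -> dot v v = 1 -> dot u v = 0 ->
  (forall y, y \in V -> dot u y = 0) -> (forall y, y \in V -> dot v y = 0) ->
  dot u x = 0 -> dot v x = 0 -> x \in V.
Proof.
move=> Vn uu vv uv uV vV ux vx; apply/negPn/negP => xV.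
have : v \in (V + <[x]>)%VS.
  apply: (@hyperplane_mem _ u) => //.
  - by rewrite dim_addv_line.
  - by apply/eqP => u0; move: uu; rewrite u0 dot0l => /eqP; rewrite eq_sym oner_eq0.
  - move=> y /memv_addP[y' y'V [_ /vlineP[k ->] ->]].
    by rewrite dotDr dotZr uV// ux mulr0 addr0.
case/memv_addP => y yV [_ /vlineP[k ->] vE].
by move/eqP: vv; rewrite {2}vE dotE vV// dotZr vx mulr0 addr0 eq_sym oner_eq0.
Qed.

End DotProduct.

(** * Convex hulls and directions *)

Definition pt (R : realType) n (x y : 'rV[R]_n) (t : R) := x + t *: (y - x).

Ltac vec := apply/rowP => ?; rewrite /pt !mxE; ring.
Ltac vecf := apply/rowP => ?; rewrite /pt !mxE; field.

Lemma dot_is_linear (R : realType) n (u : 'rV[R]_n) :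
  linear (dot u : 'rV[R]_n -> R^o).
Proof. by move=> k x y; rewrite dotDr dotZr. Qed.

HB.instance Definition _ (R : realType) n (u : 'rV[R]_n) :=
  GRing.isLinear.Build R 'rV[R]_n R^o *:%R (dot u : 'rV[R]_n -> R^o)
    (dot_is_linear u).

Section Convexity.
Variables (R : realType) (n : nat).
Local Notation E := 'rV[R]_n.
Implicit Types (x y z a u v w : E) (V W : {vspace E}) (A : set E) (t : R).

Lemma ptE x y t : pt x y t = (1 - t) *: x + t *: y.
Proof. vec. Qed.

Lemma pt0 x y : pt x y 0 = x.
Proof. vec. Qed.

Lemma pt1 x y : pt x y 1 = y.
Proof. vec. Qed.

Lemma is_convexP A : is_convex A <->
  forall x y t, 0 <= t <= 1 -> A x -> A y -> A (pt x y t).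
Proof.
split=> [cA x y t t01 Ax Ay|cA x y l /[!in_setE] Ax Ay].
  have t01' : Itv.spec (Itv.num_sem (R := R)) (Itv.Real `[0%Z, 1%Z]) t.
    rewrite /Itv.spec/= /Itv.num_sem/= num_real/= in_itv/= //.
  pose l : {i01 R} := Itv.mk t01'.
  have := cA y x l; rewrite !in_setE => /(_ Ay Ax).
  rewrite ptE addrC; exact.
rewrite -[X in A X]/(l%:num *: x + (1 - l%:num) *: y)%R addrC -ptE.
by apply: cA => //; rewrite ge0 le1.
Qed.

Lemma pt_conv A x y t : is_convex A -> A x -> A y -> 0 <= t -> t <= 1 -> A (pt x y t).
Proof. by move=> /is_convexP cA Ax Ay t0 t1; apply: cA => //; rewrite t0. Qed.

Lemma hull_convex A : is_convex (convex_hull A).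
Proof.
apply/is_convexP => x y t /andP[t0 t1] hx hy C [cC AC].
by apply: pt_conv => //; [apply: hx|apply: hy].
Qed.

Lemma sub_hull A : A `<=` convex_hull A.
Proof. by move=> x Ax C [_]; apply. Qed.

Lemma hull_min A C : is_convex C -> A `<=` C -> convex_hull A `<=` C.
Proof. by move=> cC AC x; apply. Qed.

Lemma hull_mono A B : A `<=` B -> convex_hull A `<=` convex_hull B.
Proof.
move=> AB; apply: hull_min; first exact: hull_convex.
by move=> x /AB; exact: sub_hull.
Qed.

Lemma hull_nil : convex_hull [set` [::] : seq E] = set0.
Proof.
apply/seteqP; split => // x; apply; split => [|y //].
by apply/is_convexP.
Qed.

(** The weights of a combination of two points of the join regroup into the weight
    of x and one combination of points of the hull; when only x has a positive
    weight, any point of the hull serves. *)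
Lemma hull_cons x (s : seq E) : s != [::] -> convex_hull [set` x :: s] =
  (fun p : R * E => pt x p.2 p.1) @` (`[0, 1] `*` convex_hull [set` s]).
Proof.
case: s => // a s' _; set s := a :: s'.
have hs : forall y, y \in s -> convex_hull [set` s] y.
  by move=> y ys; apply: sub_hull.
apply/seteqP; split.
  apply: hull_min; last first.
    move=> y /=; rewrite in_cons => /orP[/eqP ->|ys]; last first.
      by exists (1, y); [split; [rewrite /= in_itv/= lexx ler01|exact: hs]|rewrite pt1].
    exists (0, a); last by rewrite pt0.
    by split; [rewrite /= in_itv/= lexx ler01|apply: hs; rewrite mem_head].
  apply/is_convexP => _ _ t /andP[t0 t1] [[k y] [/= k01 hy] <-] [[l z] [/= l01 hz] <-].
  move: k01 l01; rewrite !in_itv/= => /andP[k0 k1] /andP[l0 l1].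
  set m := (1 - t) * k + t * l.
  have tl0 : 0 <= t * l by exact: mulr_ge0.
  have tk0 : 0 <= (1 - t) * k by apply: mulr_ge0 => //; rewrite subr_ge0.
  have [m0|m0] := eqVneq m 0.
    have l0' : t * l = 0 by rewrite /m in m0; lra.
    have k0' : (1 - t) * k = 0 by rewrite /m in m0; lra.
    exists (0, a); first by split; [rewrite /= in_itv/= lexx ler01|apply: hs; rewrite mem_head].
    rewrite /= /pt; apply/rowP => i; rewrite !mxE.
    transitivity (x 0 i + (1 - t) * k * (y 0 i - x 0 i) + t * l * (z 0 i - x 0 i)); last by ring.
    by rewrite l0' k0'; ring.
  have m_gt0 : 0 < m by rewrite lt_neqAle eq_sym m0 addr_ge0.
  exists (m, pt y z (t * l / m)); last first.
    transitivity (x + m *: (y - x) + (t * l) *: (z - y)); last by rewrite /m; vec.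
    by rewrite /=; clearbody m; vecf.
  split; rewrite /= ?in_itv/=.
    rewrite ltW//= /m; nra.
  apply: pt_conv => //; first exact: hull_convex.
    by rewrite divr_ge0// ltW.
  by rewrite ler_pdivrMr// mul1r /m lerDr.
move=> _ [[k y] [/= + hy] <-]; rewrite in_itv/= => /andP[k0 k1].
apply: pt_conv => //; first exact: hull_convex.
  by apply: sub_hull; rewrite /= mem_head.
by apply: hull_mono hy => z /= zs; rewrite in_cons zs orbT.
Qed.

Lemma hull_compact (s : seq E) : compact (convex_hull [set` s]).
Proof.
elim: s => [|x s IH]; first by rewrite hull_nil; exact: compact0.
have [->|s0] := eqVneq s [::].
  rewrite (_ : convex_hull _ = [set x]); first exact: compact_set1.
  apply/seteqP; split.
    apply: hull_min => [|y /=]; last by rewrite inE => /eqP.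
    by apply/is_convexP => y z t _ -> ->; rewrite /pt subrr scaler0 addr0.
  by move=> _ ->; apply: sub_hull; rewrite /= mem_head.
rewrite hull_cons//; apply: continuous_compact; last first.
  by apply: compact_setX => //; exact: segment_compact.
apply: continuous_subspaceT => p.
apply: cvgD; first exact: cvg_cst.
apply: cvgZ; first exact: cvg_fst.
by apply: cvgB; [exact: cvg_snd|exact: cvg_cst].
Qed.

Lemma polytope_closed A : polytope A -> closed A.
Proof.
move=> [s ->]; apply: compact_closed; last exact: hull_compact.
exact: norm_hausdorff.
Qed.

Lemma polytope_convex A : polytope A -> is_convex A.
Proof. by move=> [s ->]; exact: hull_convex. Qed.

(** An intersection of subspaces that contain all differences has smaller
    dimension unless it is one of them, so a subspace of least dimension is the
    least one. *)
Lemma direction_ex A : exists V, is_direction A V.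
Proof.
pose C V := forall x y, A x -> A y -> x - y \in V.
pose p k := `[< exists2 V, C V & \dim V = k >].
have exp : exists k, p k.
  by exists (\dim {:E}); apply/asboolP; exists fullv => // x y _ _; exact: memvf.
have [k /asboolP[V CV Vk] kmin] := ex_minnP exp.
exists V; split=> // W CW.
have : (\dim V <= \dim (V :&: W))%N.
  rewrite Vk; apply: kmin; apply/asboolP; exists (V :&: W)%VS => // x y Ax Ay.
  by rewrite memv_cap CV ?CW.
by rewrite (geq_leqif (dimv_leqif_eq (capvSl V W))) => /eqP <-; exact: capvSr.
Qed.

Definition dir A : {vspace E} := projT1 (cid (direction_ex A)).

Lemma dirP A : is_direction A (dir A).
Proof. by rewrite /dir; case: cid. Qed.

Lemma dir_uniq A V : is_direction A V -> V = dir A.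
Proof.
move=> [CV Vmin]; have [Cd dmin] := dirP A.
by apply/eqP; rewrite eqEsubv Vmin ?dmin.
Qed.

Lemma mem_dir A x y : A x -> A y -> x - y \in dir A.
Proof. by have [+ _] := dirP A; exact. Qed.

Lemma dir_min A V x : A x -> (forall y, A y -> y - x \in V) -> (dir A <= V)%VS.
Proof.
move=> Ax AV; have [_] := dirP A; apply => y z Ay Az.
by rewrite -(subrK x y) -addrA memvD ?AV// -opprB memvN AV.
Qed.

Lemma dir_mono A B : A `<=` B -> (dir A <= dir B)%VS.
Proof.
by move=> AB; have [_] := dirP A; apply => x y /AB + /AB; exact: mem_dir.
Qed.

Lemma has_dimP A k : has_dim A k <-> A !=set0 /\ \dim (dir A) = k.
Proof.
split=> [[A0 [V /dir_uniq -> Vk]]|[A0 Ak]]; first by [].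
by split => //; exists (dir A) => //; exact: dirP.
Qed.

Lemma normal_to_dir u A : normal_to u A <-> forall w, w \in dir A -> dot u w = 0.
Proof.
split=> [uA w wA|uA x y Ax Ay]; last by rewrite uA// mem_dir.
have [_ dmin] := dirP A.
have : (dir A <= lker (linfun (dot u : E -> R^o)))%VS.
  by apply: dmin => x y Ax Ay; rewrite memv_ker lfunE/= uA.
by move=> /subvP/(_ _ wA); rewrite memv_ker lfunE/= => /eqP.
Qed.

(** Induction on k: the first terms, rescaled by 1 - c k, give one point of A,
    which is then joined to x + b k. *)
Lemma conv_comb A x (k : nat) (b : 'I_k -> E) (c : 'I_k -> R) : is_convex A -> A x ->
  (forall i, A (x + b i)) -> (forall i, 0 <= c i) ->
  \sum_(i < k) c i <= 1 -> A (x + \sum_(i < k) c i *: b i).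
Proof.
move=> cA Ax; elim: k b c => [b c _ _ _|k IH b' c' Ab c0']; first by rewrite big_ord0 addr0.
rewrite !big_ord_recr/=.
set c := fun i : 'I_k => c' (widen_ord (leqnSn k) i).
set b := fun i : 'I_k => b' (widen_ord (leqnSn k) i).
set ck := c' ord_max; set bk := b' ord_max.
rewrite -/(\sum_(i < k) c i) -/(\sum_(i < k) c i *: b i) => c1.
have c0 i : 0 <= c i by exact: c0'.
have s0 : 0 <= \sum_(i < k) c i by apply: sumr_ge0 => i _.
have ck0 : 0 <= ck by exact: c0'.
have [ckE|ckN] := eqVneq ck 1.
  rewrite ckE scale1r big1 ?add0r; first exact: Ab.
  have : \sum_(i < k) c i = 0 by lra.
  move=> /eqP; rewrite psumr_eq0 => [/allP H i _|i _]; last exact: c0.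
  by have /eqP -> := H i (mem_index_enum _); rewrite scale0r.
have ck1 : 0 < 1 - ck by rewrite subr_gt0 lt_neqAle ckN/=; lra.
rewrite (_ : x + _ = pt (x + \sum_(i < k) (c i / (1 - ck)) *: b i) (x + bk) ck).
  apply: pt_conv => //; [|exact: Ab|lra].
  apply: IH => [i|i|].
  - exact: Ab.
  - by rewrite divr_ge0// ltW.
  - by rewrite -mulr_suml ler_pdivrMr//; lra.
rewrite /pt.
under [in RHS]eq_bigr do rewrite mulrC -scalerA.
rewrite -scaler_sumr.
by clearbody ck; vecf; rewrite gt_eqF.
Qed.

Lemma linear_dot (f : {linear E -> R^o}) : exists a, forall x, f x = dot a x.
Proof.
exists (\row_i f (delta_mx 0 i)) => x.
rewrite {1}(row_sum_delta x) linear_sum; apply: eq_bigr => i _.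
by rewrite linearZ mxE/= mulrC.
Qed.

(** Finitely many differences span the direction of A; the barycentre of the
    corresponding points is relatively interior. *)
Lemma relint_ex A : is_convex A -> A !=set0 ->
  exists2 x, A x & exists2 r : R, 0 < r &
    forall w, w \in dir A -> `|w| < r -> A (x + w).
Proof.
move=> cA [x Ax].
pose p k := `[< exists2 X : seq E, (forall b, b \in X -> A (x + b)) & \dim <<X>>%VS = k >].
have exp : exists k, p k.
  by exists 0%N; apply/asboolP; exists [::] => //; rewrite span_nil dimv0.
have pn k : p k -> (k <= n)%N by move=> /asboolP[X _ <-]; exact: dim_leq.
have [k /asboolP[X AX Xk] kmax] := ex_maxnP exp pn.
have dX : (dir A <= <<X>>)%VS.
  apply: (dir_min Ax) => y Ay; apply/negPn/negP => yX.
  have : p (\dim <<(y - x) :: X>>).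
    apply/asboolP; exists ((y - x) :: X) => // b; rewrite in_cons => /orP[/eqP ->|]; last exact: AX.
    by rewrite addrC subrK.
  move=> /kmax; rewrite span_cons addvC dim_addv_line// Xk.
  by rewrite ltnn.
have X_ i : (i < size X)%N -> A (x + X`_i) by move=> iX; apply: AX; exact: mem_nth.
pose m := size X; pose f i := (coord (in_tuple X) i : {linear E -> R^o}).
have [a fa] := choice (fun i => linear_dot (f i)).
have [C C0 aC] := dot_bound_fin a.
pose K : R := m%:R + 1.
have K0 : 0 < K by rewrite ltr_wpDl.
pose e := K^-1 ^+ 2.
have e0 : 0 < e by rewrite exprn_gt0// invr_gt0.
have Ke : K * (K * e) = 1 by rewrite /e; field; rewrite gt_eqF.
have Kinv : K^-1 = K * e by rewrite /e; field; rewrite gt_eqF.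
exists (x + \sum_(i < m) K^-1 *: X`_i).
  apply: conv_comb => // [i|i|]; [exact: X_|by rewrite invr_ge0 ltW|].
  rewrite sumr_const card_ord -[_ *+ _]mulr_natr mulrC ler_pdivrMr// mul1r.
  by rewrite /K lerDl.
exists (e / C); first exact: divr_gt0.
move=> w wA wr; have wX := subvP dX _ wA.
have wE := coord_span (X := in_tuple X) wX.
rewrite [X in A (_ + X)]wE -addrA -big_split/=.
under eq_bigr do rewrite -scalerDl.
have ce i : `|f i w| < e.
  by rewrite fa (le_lt_trans (aC _ _))// mulrC -ltr_pdivlMr.
have m0 : (0 : R) <= m%:R by [].
apply: (@conv_comb _ _ m (fun i => X`_i) (fun i => K^-1 + f i w)) => // [i|i|].
- exact: X_.
- by have := ce i; rewrite ltr_norml Kinv /K => /andP[]; nra.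
apply: (@le_trans _ _ (\sum_(i < m) (K^-1 + e))).
  by apply: ler_sum => i _; rewrite lerD2l ltW// (le_lt_trans (ler_norm _) (ce i)).
rewrite sumr_const card_ord -[_ *+ _]mulr_natr Kinv; move: Ke; rewrite /K; nra.
Qed.

End Convexity.

(** * Interior points, thin sets, and subdivision of intervals *)

Section Position.
Variables (R : realType) (n : nat).
Local Notation E := 'rV[R]_n.
Implicit Types (x y z a u v w : E) (V W : {vspace E}) (A : set E) (t : R).

(** A point from which every segment of A can be prolonged is a convex
    combination of a relatively interior point and a point beyond it. *)
Lemma relint_reversal A z : is_convex A -> A z ->
  (forall f, A f -> exists2 e : R, 0 < e & A (z - e *: (f - z))) ->
  exists2 r : R, 0 < r & forall w, w \in dir A -> `|w| < r -> A (z + w).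
Proof.
move=> cA Az rev.
have [x Ax [r r0 xr]] : exists2 x, A x & exists2 r : R, 0 < r &
    forall w, w \in dir A -> `|w| < r -> A (x + w).
  by apply: relint_ex => //; exists z.
have [e e0 Ae] := rev x Ax.
have e1 : 0 < 1 + e by rewrite addr_gt0.
pose k := e / (1 + e).
have k0 : 0 < k by rewrite divr_gt0.
exists (r * k); first by rewrite mulr_gt0.
move=> w wA wr.
rewrite (_ : z + w = pt (z - e *: (x - z)) (x + k^-1 *: w) k).
  apply: pt_conv => //; [|exact: ltW|].
    apply: xr; first exact: memvZ.
    by rewrite normrZ gtr0_norm ?invr_gt0// ltr_pdivrMl// mulrC.
  by rewrite ler_pdivrMr// mul1r; lra.
by rewrite /k; vecf; rewrite !gt_eqF.
Qed.

(** The point lies on the segment from z + w / (1 - l), which is in the disc, to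
    z + e; this needs l to stay away from 1. *)
Lemma disc_join A V z (r : R) e : is_convex A ->
  (forall w, w \in V -> `|w| < r -> A (z + w)) -> A (z + e) ->
  forall w (l : R), w \in V -> `|w| < r / 2 -> 0 <= l -> l <= 2^-1 ->
  A (z + w + l *: e).
Proof.
move=> cA Vr Ae w l wV wr l0 l1.
have l2 : 0 < 1 - l by lra.
rewrite (_ : _ + _ = pt (z + (1 - l)^-1 *: w) (z + e) l); last first.
  by vecf; rewrite gt_eqF.
apply: pt_conv => //; last by lra.
apply: Vr; first exact: memvZ.
rewrite normrZ gtr0_norm ?invr_gt0// mulrC ltr_pdivrMr//.
have := normr_ge0 w; nra.
Qed.

(** Subtracting from w the multiple of e with the same component along u leaves a
    small vector of V. *)
Lemma half_ball A V z (r : R) u e : is_convex A -> (n <= (\dim V).+1)%N ->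
  (forall y, y \in V -> dot u y = 0) -> 0 < r ->
  (forall w, w \in V -> `|w| < r -> A (z + w)) -> A (z + e) -> 0 < dot u e ->
  exists2 s : R, 0 < s & forall w, `|w| < s -> 0 <= dot u w -> A (z + w).
Proof.
move=> cA Vn uV r0 Vr Ae ue.
have [C C0 uC] := dot_bound u.
pose D := 1 + C / dot u e * `|e|.
have D0 : 0 < D by rewrite ltr_pwDl// !mulr_ge0// ?invr_ge0 ltW.
exists (Num.min (r / 2 / D) (dot u e / 2 / C)).
  by rewrite lt_min !divr_gt0.
move=> w; rewrite lt_min (ltr_pdivlMr _ _ D0) (ltr_pdivlMr _ _ C0) => /andP[wr wC] uw.
pose l := dot u w / dot u e.
rewrite (_ : z + w = z + (w - l *: e) + l *: e); last by vec.
have l0 : 0 <= l by rewrite divr_ge0// ltW.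
apply: (disc_join cA Vr) => //.
- apply: (hyperplane_mem Vn _ uV).
    by apply: contraTneq ue => ->; rewrite dot0l ltxx.
  by rewrite dotBr dotZr divfK ?subrr// gt_eqF.
- rewrite (le_lt_trans _ wr)// (le_trans (ler_normB _ _))// /D mulrDr mulr1.
  rewrite lerD2l normrZ ger0_norm// mulrA ler_wpM2r// /l ler_pdivrMr//.
  rewrite -mulrA divfK ?gt_eqF// mulrC.
  by rewrite (le_trans (ler_norm _))// uC.
- rewrite ler_pdivrMr//; move: (uC w) wC; rewrite ger0_norm//; lra.
Qed.

Lemma segment_interior A p c t : is_convex A -> A p -> A^° c -> 0 < t -> t <= 1 ->
  A^° (pt p c t).
Proof.
move=> cA Ap /nbhs_shiftP[e e0 eA] t0 t1; apply/nbhs_shiftP.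
exists (t * e); first exact: mulr_gt0.
move=> w wt; rewrite (_ : pt p c t + w = pt p (c + t^-1 *: w) t).
  apply: pt_conv => //; last exact: ltW.
  by apply: eA; rewrite normrZ gtr0_norm ?invr_gt0// ltr_pdivrMl.
by vecf; rewrite gt_eqF.
Qed.

Lemma interior_dense A p c (U : set E) : is_convex A -> A p -> A^° c -> nbhs p U ->
  exists2 q, A^° q & U q.
Proof.
move=> cA Ap Ac /nbhs_shiftP[e e0 eU].
pose t := Num.min 1 (e / (1 + `|c - p|) / 2).
have D0 : 0 < 1 + `|c - p| by rewrite ltr_pwDl.
have t0 : 0 < t by rewrite lt_min ltr01 !divr_gt0.
exists (pt p c t); first by apply: segment_interior => //; rewrite ge_min lexx.
apply: eU; rewrite normrZ gtr0_norm//.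
have : t <= e / (1 + `|c - p|) / 2 by rewrite ge_min lexx orbT.
rewrite ler_pdivlMr// ler_pdivlMr//; have := normr_ge0 (c - p); nra.
Qed.

Lemma full_dim_interior A : is_convex A -> has_dim A n -> A^° !=set0.
Proof.
move=> cA /has_dimP[A0 An]; have [x Ax [r r0 xr]] := relint_ex cA A0.
exists x; apply/nbhs_shiftP; exists r => // w; apply: xr; exact: mem_dim_full.
Qed.

Lemma interior_full_dim A : A^° !=set0 -> \dim (dir A) = n.
Proof.
move=> [x /nbhs_shiftP[e e0 eA]].
suff -> : dir A = fullv by exact: dim_rV.
apply/eqP; rewrite eqEsubv subvf/=; apply/subvP => y _.
pose k := e / 2 / (1 + `|y|).
have D0 : 0 < 1 + `|y| by rewrite ltr_pwDl.
have k0 : 0 < k by rewrite !divr_gt0.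
rewrite -[y](scalerK (lt0r_neq0 k0)) memvZ//.
rewrite (_ : _ *: y = (x + k *: y) - x); last by vec.
have ke : `|k *: y| < e.
  rewrite normrZ gtr0_norm// mulrAC ltr_pdivrMr// mulrAC ltr_pdivrMr//.
  by have := normr_ge0 y; nra.
apply: mem_dir; first exact: eA.
by rewrite -[x]addr0; apply: eA; rewrite normr0.
Qed.

(** Thin sets are stable under finite unions and contain no nonempty open set. *)
Definition thin A := exists2 hs : seq (E * R), (forall h, h \in hs -> h.1 != 0) &
  forall x, A x -> exists2 h, h \in hs & dot h.1 x = h.2.

Lemma thinS A B : A `<=` B -> thin B -> thin A.
Proof. by move=> AB [hs hs0 Bh]; exists hs => // x /AB /Bh. Qed.

Lemma thinU A B : thin A -> thin B -> thin (A `|` B).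
Proof.
move=> [hs hs0 Ah] [ks ks0 Bk]; exists (hs ++ ks).
  by move=> h; rewrite mem_cat => /orP[/hs0|/ks0].
by move=> x [/Ah|/Bk] [h hh hx]; exists h => //; rewrite mem_cat hh ?orbT.
Qed.

Lemma thin_hyperplane a (b : R) : a != 0 -> thin [set x | dot a x = b].
Proof. by move=> a0; exists [:: (a, b)] => [h|x xb]; [rewrite inE => /eqP ->|exists (a, b); rewrite ?mem_head]. Qed.

Lemma thin_subspace V p : (\dim V < n)%N -> thin [set x | x - p \in V].
Proof.
move=> /proper_vspace_normal[a a0 aV]; apply: thinS (thin_hyperplane (dot a p) a0).
by move=> x /= /aV /eqP; rewrite dotBr subr_eq0 => /eqP.
Qed.

Lemma thin_bigcup (I : finType) (F : I -> set E) :
  (forall i, thin (F i)) -> thin (\bigcup_i F i).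
Proof.
move=> thF; suff : thin [set x | exists2 i, i \in enum I & F i x].
  by apply: thinS => x [i _ Fx]; exists i; rewrite ?mem_enum.
elim: (enum I) => [|i s IH]; first by exists [::] => // x [].
apply: thinS (thinU (thF i) IH) => x [j]; rewrite in_cons => /orP[/eqP ->|js]; first by left.
by right; exists j.
Qed.

Lemma thin_avoid A x (U : set E) : thin A -> nbhs x U -> exists2 y, U y & ~ A y.
Proof.
move=> [hs hs0 Ah]; suff : forall U : set E, nbhs x U -> exists2 y, nbhs y U &
    forall h, h \in hs -> dot h.1 y != h.2.
  move=> H xU; have [y yU yh] := H _ xU; exists y; first exact: nbhs_singleton.
  by move=> /Ah[h hh yE]; move: (yh _ hh); rewrite yE eqxx.
elim: hs hs0 {Ah} => [_ V xV|h hs IH hs0 V xV]; first by exists x.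
have [||y yV yh] := IH _ V => // [k ks|]; first by apply: hs0; rewrite in_cons ks orbT.
have h0 : h.1 != 0 by apply: hs0; rewrite mem_head.
have [yhE|yhN] := eqVneq (dot h.1 y) h.2; last first.
  by exists y => // k; rewrite in_cons => /orP[/eqP ->|/yh].
(* Moving along the normal h leaves this hyperplane; a short move neither
   leaves V nor meets the other hyperplanes. *)
have [C C0 yC] : exists2 C : R, 0 < C & forall t, 0 < t -> t < C ->
    nbhs (y + t *: h.1) V /\ forall k, k \in hs -> dot k.1 (y + t *: h.1) != k.2.
  elim: hs yh {IH hs0} => [_|k hs IH yh].
    have /nbhs_shiftP[e e0 eV] : nbhs y V^° by exact: nbhs_interior.
    have D0 : 0 < 1 + `|h.1| by rewrite ltr_pwDl.
    exists (e / (1 + `|h.1|)); first exact: divr_gt0.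
    move=> t t0; rewrite ltr_pdivlMr// => tC; split => //; apply: eV.
    by rewrite normrZ gtr0_norm//; nra.
  have [|C C0 yC] := IH; first by move=> l lh; apply: yh; rewrite in_cons lh orbT.
  have [k0 kC] := dot_bound k.1.
  have kN : dot k.1 y - k.2 != 0 by rewrite subr_eq0 yh// mem_head.
  have D0 : 0 < 1 + `|dot k.1 h.1| by rewrite ltr_pwDl.
  exists (Num.min C (`|dot k.1 y - k.2| / (1 + `|dot k.1 h.1|))).
    by rewrite lt_min C0 divr_gt0// normr_gt0.
  move=> t t0; rewrite lt_min (ltr_pdivlMr _ _ D0) => /andP[tC tk].
  have [yV' yhs] := yC t t0 tC; split => // l; rewrite in_cons => /orP[/eqP ->|/yhs//].
  apply: contraTneq tk => kE; rewrite -leNgt.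
  rewrite (_ : dot k.1 y - k.2 = - (t * dot k.1 h.1)); last by rewrite -kE dotDr dotZr; ring.
  by rewrite normrN normrM gtr0_norm//; nra.
have [yV' yhs] := yC (C / 2) (divr_gt0 C0 (ltr0Sn _ _)) ltac:(lra).
exists (y + (C / 2) *: h.1) => // k; rewrite in_cons => /orP[/eqP ->|/yhs//].
rewrite dotDr dotZr yhE -subr_eq0 addrAC subrr add0r mulf_neq0//.
  by rewrite gt_eqF// divr_gt0.
by rewrite gt_eqF// dotxx_gt0.
Qed.

End Position.

(** Compactness of the unit interval, in the form of Cousin.  Only nondegenerate
    intervals occur: along a segment, the property would fail for a single point
    at which the segment changes cells. *)
Lemma cousin (R : realType) (Q : R -> R -> Prop) :
  (forall a b c, a < b -> b < c -> Q a b -> Q b c -> Q a c) ->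
  (forall t, 0 <= t -> t <= 1 -> exists2 e : R, 0 < e & forall a b,
     0 <= a -> b <= 1 -> a < b -> a <= t -> t <= b -> t - e < a -> b < t + e -> Q a b) ->
  Q 0 1.
Proof.
move=> Qtr Qloc.
pose S := [set t : R | 0 < t /\ t <= 1 /\ Q 0 t].
have [e0 e0_gt0 Q0] := Qloc 0 (lexx _) ler01.
have Sne : S (Num.min 1 (e0 / 2)).
  have e2 : e0 / 2 < e0 by lra.
  have m0 : 0 < Num.min 1 (e0 / 2) by rewrite lt_min ltr01 divr_gt0.
  split => //; split; first by rewrite ge_min lexx.
  apply: Q0 => //; rewrite ?ge_min ?lexx//; first exact: ltW.
  - by rewrite sub0r oppr_lt0.
  - by rewrite add0r gt_min e2 orbT.
have supS : has_sup S by split; [eexists; exact: Sne|exists 1 => t [_ []]].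
set s := sup S.
have s1 : s <= 1 by apply: ge_sup; [exact: supS.1|move=> t [_ []]].
have Ss t : S t -> t <= s by move=> St; apply: ub_le_sup; first exact: supS.2.
have s0 : 0 <= s by rewrite (le_trans _ (Ss _ Sne))// ltW//; case: Sne.
have [e e_gt0 Qs] := Qloc s s0 s1.
have [t St st] := sup_adherent e_gt0 supS; rewrite -/s in st.
have ts := Ss _ St; case: St => t0 [t1 Qt].
have up b : s <= b -> b <= 1 -> b < s + e -> t < b -> Q 0 b.
  move=> sb b1 be tb; apply: (Qtr _ t) => //; apply: Qs => //; exact: ltW.
have [sE|sN] := eqVneq s 1.
  have [tE|tN] := eqVneq t 1; first by rewrite -tE.
  by apply: up; rewrite ?sE// ?ltrDl// lt_neqAle tN.
have s1' : s < 1 by rewrite lt_neqAle sN.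
have sb : s < Num.min 1 (s + e / 2) by rewrite lt_min s1' ltrDl divr_gt0.
have : S (Num.min 1 (s + e / 2)).
  split; first exact: le_lt_trans sb.
  split; first by rewrite ge_min lexx.
  apply: up; rewrite ?ge_min ?lexx//; [exact: ltW| |exact: le_lt_trans sb].
  by rewrite gt_min; apply/orP; right; lra.
by move=> /Ss; rewrite leNgt sb.
Qed.

(** * Carriers of points *)

Lemma finite_radius (R : realType) (I : choiceType) (S : set I) (phi : I -> R -> Prop) :
  finite_set S -> (forall i e e', e' <= e -> phi i e -> phi i e') ->
  (forall i, S i -> exists2 e : R, 0 < e & phi i e) ->
  exists2 e : R, 0 < e & forall i, S i -> phi i e.
Proof.
move=> /finite_seqP[s ->] mono; elim: s => [_|i s IH H]; first by exists 1.
have [|e e0 es] := IH; first by move=> j js; apply: H; rewrite /= in_cons (js : j \in s) orbT.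
have [f f0 fi] : exists2 f : R, 0 < f & phi i f by apply: H; rewrite /= mem_head.
exists (Num.min e f); first by rewrite lt_min e0.
move=> j /=; rewrite in_cons => /orP[/eqP ->|js].
  by apply: mono fi; rewrite ge_min lexx orbT.
by apply: mono (es _ js); rewrite ge_min lexx.
Qed.

(** The supporting functional is at most c at both ends and equals c inside. *)
Lemma face_extremal (R : realType) n (F P : set 'rV[R]_n) a b t :
  is_face F P -> P a -> P b -> 0 < t -> t < 1 -> F (pt a b t) -> F a /\ F b.
Proof.
move=> [u [c [Pc ->]]] Pa Pb t0 t1 [_ /=]; rewrite /pt dotDr dotZr dotBr => abc.
have ac := Pc _ Pa; have bc := Pc _ Pb.
by split; split => //=; nra.
Qed.

Section TilingStructure.
Variables (R : realType) (d : nat) (T : set (set 'rV[R]_d)).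
Hypothesis tilingT : locally_finite_normal_tiling T.
Local Notation E := 'rV[R]_d.
Implicit Types (x y z a u v w : E) (P Q S F H : set E) (t : R).

Lemma cell_convex P : T P -> is_convex P.
Proof. by case: tilingT => -[+ _ _ _ _] => /[apply] -[/polytope_convex]. Qed.

Lemma cell_closed P : T P -> closed P.
Proof. by case: tilingT => -[+ _ _ _ _] => /[apply] -[/polytope_closed]. Qed.

Lemma cell_interior P : T P -> P^° !=set0.
Proof.
move=> TP; apply: full_dim_interior; first exact: cell_convex.
by case: tilingT => -[/(_ P TP)[]].
Qed.

Lemma cell_dense P x U : T P -> P x -> nbhs x U -> exists2 q, P^° q & U q.
Proof.
move=> TP Px xU; have [c Pc] := cell_interior TP.
exact: interior_dense (cell_convex TP) Px Pc xU.
Qed.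

Lemma cell_cover x : exists2 P, T P & P x.
Proof.
case: tilingT => -[_ cov _] _ _.
by have : setT x by []; rewrite -cov => -[P TP Px]; exists P.
Qed.

Lemma interior_cell_uniq P Q x : T P -> T Q -> P^° x -> Q x -> P = Q.
Proof.
move=> TP TQ Px Qx; apply: contrapT => PQ.
have [q Qq Pq] : exists2 q, Q^° q & P^° q.
  by apply: (cell_dense TQ Qx); exact: nbhs_interior.
case: tilingT => -[_ _ /(_ P Q TP TQ PQ) PQ0] _ _.
by have : (P^° `&` Q^°) q by []; rewrite PQ0.
Qed.

Lemma cells_near x : exists2 e : R, 0 < e &
  forall y, `|y - x| < e -> forall P, T P -> P y -> P x.
Proof.
case: tilingT => _ /(_ x)[U xU finS] _.
have [f f0 fU] := (nbhs_shiftP x U).1 xU.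
have [P e e' ee' He y xy|P [TP PU]|e e0 eS] := @finite_radius R _ _
   (fun P e => forall y, `|y - x| < e -> P y -> P x) finS.
- by apply: He; exact: lt_le_trans ee'.
- have [Px|Px] := pselect (P x); first by exists 1.
  have : nbhs x (~` P).
    by apply: open_nbhs_nbhs; split => //; apply: closed_openC; exact: cell_closed.
  move=> /nbhs_shiftP[e e0 eP]; exists e => // y xy Py; exfalso.
  by apply: (eP (y - x)) => //; rewrite addrC subrK.
exists (Num.min e f); first by rewrite lt_min e0.
move=> y; rewrite lt_min => /andP[ye yf] P TP Py; apply: (eS P _ y) => //.
split => //; exists y; split => //.
by rewrite -(subrK x y) addrC; exact: fU.
Qed.

(** The carrier of x is the face of the tiling that contains x in its relative
    interior. *)
Definition carrier x : set E := [set y | forall P, T P -> P x -> P y].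

(** The dimension of the carrier; the codimension of x is d - rk x. *)
Definition rk x := \dim (dir (carrier x)).

Lemma carrier_refl x : carrier x x.
Proof. by []. Qed.

Lemma carrier_convex x : is_convex (carrier x).
Proof.
apply/is_convexP => y z t /andP[t0 t1] xy xz P TP Px.
by apply: pt_conv => //; [exact: cell_convex|exact: xy|exact: xz].
Qed.

Lemma carrier_mono x y : (forall P, T P -> P y -> P x) -> carrier x `<=` carrier y.
Proof. by move=> yx z xz P TP Py; apply: xz => //; exact: yx. Qed.

Lemma rk_mono x y : (forall P, T P -> P y -> P x) -> (rk x <= rk y)%N.
Proof. by move=> yx; apply: dimvS; apply: dir_mono; exact: carrier_mono. Qed.

Lemma cells_meet_face P Q x : T P -> T Q -> P x -> Q x ->
  is_face (P `&` Q) P /\ is_face (P `&` Q) Q.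
Proof.
move=> TP TQ Px Qx; case: tilingT => _ _ /(_ P Q TP TQ)[PQ0|//].
by have : (P `&` Q) x by []; rewrite PQ0.
Qed.

(** Just beyond x on a segment of the carrier lies a cell Q through x.  It
    contains the whole carrier, so the prolonged segment lies in Q and has x in
    its interior; hence the face that Q shares with any other cell at x
    contains the prolonged segment. *)
Lemma carrier_relint x : exists2 r : R, 0 < r &
  forall w, w \in dir (carrier x) -> `|w| < r -> carrier x (x + w).
Proof.
apply: (relint_reversal (@carrier_convex x)) => // f xf.
have [e e0 xe] := cells_near x.
have D0 : 0 < 1 + `|f - x| by rewrite ltr_pwDl.
pose k := e / (1 + `|f - x|).
have k0 : 0 < k by rewrite divr_gt0.
exists k => // P TP Px; set y := x - _.
have [Q TQ Qy] := cell_cover y.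
have Qx : Q x.
  apply: (xe y) => //; rewrite /y addrC addKr normrN normrZ gtr0_norm//.
  by rewrite mulrAC ltr_pdivrMr//; nra.
have [_ fQ] := cells_meet_face TP TQ Px Qx.
have k1 : 0 < 1 + k by rewrite addr_gt0.
have [] := face_extremal (t := k / (1 + k)) fQ Qy (_ : Q f).
- exact: xf.
- by rewrite divr_gt0.
- by rewrite ltr_pdivrMr// mul1r ltrDr.
- rewrite (_ : pt _ _ _ = x)//.
  by rewrite /y; clearbody k; vecf; rewrite gt_eqF.
by case.
Qed.

Lemma interior_rk P x : T P -> P^° x -> rk x = d.
Proof.
move=> TP Px; apply: interior_full_dim; exists x.
apply: (filterS _ Px) => y Py Q TQ Qx.
by rewrite -(interior_cell_uniq TP TQ Px Qx).
Qed.

Lemma rk_interior P x : (d <= rk x)%N -> T P -> P x -> P^° x.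
Proof.
move=> dx TP Px; have [r r0 xr] := carrier_relint x.
apply/nbhs_shiftP; exists r => // w wr; apply: xr => //.
by apply: mem_dim_full; apply/eqP; rewrite eqn_leq dim_leq.
Qed.

(** Near x the tiling consists of P and Q, which fill the two half balls below and
    above the hyperplane through x with unit normal u. *)
Record two_sided x P Q u : Prop := TwoSided {
  ts_rk : (rk x).+1 = d;
  ts_cell1 : T P; ts_cell2 : T Q; ts_mem1 : P x; ts_mem2 : Q x;
  ts_only : forall S, T S -> S x -> S = P \/ S = Q;
  ts_unit : dot u u = 1;
  ts_normal : forall w, w \in dir (carrier x) -> dot u w = 0;
  ts_half1 : exists2 r : R, 0 < r & forall w, `|w| < r -> dot u w <= 0 -> P (x + w);
  ts_half2 : exists2 r : R, 0 < r & forall w, `|w| < r -> 0 <= dot u w -> Q (x + w) }.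

Lemma two_sidedC x P Q u : two_sided x P Q u -> two_sided x Q P (- u).
Proof.
case=> xd TP TQ Px Qx only uu uN [r r0 hP] [s s0 hQ]; split => //.
- by move=> S TS /(only _ TS)[]; [right|left].
- by rewrite dotNl dotNr opprK.
- by move=> w /uN; rewrite dotNl => ->; rewrite oppr0.
- by exists s => // w ws; rewrite dotNl oppr_le0; exact: hQ.
- by exists r => // w ws; rewrite dotNl oppr_ge0; exact: hP.
Qed.

Lemma unit_neq0 u : dot u u = 1 -> u != 0.
Proof. by apply: contra_eqN => /eqP ->; rewrite dot0l eq_sym oner_eq0. Qed.

Lemma small_multiple u (e : R) : 0 < e -> exists2 k : R, 0 < k & `|k *: u| < e.
Proof.
move=> e0; have D0 : 0 < 1 + `|u| by rewrite ltr_pwDl.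
exists (e / (1 + `|u|)); first exact: divr_gt0.
rewrite normrZ gtr0_norm ?divr_gt0// mulrAC ltr_pdivrMr//.
by have := normr_ge0 u; nra.
Qed.

(** Each cell at x contains the disc of the carrier and a point off its
    hyperplane, hence a half ball; two half balls on one side overlap, and two
    on different sides would make x an interior point. *)
Lemma codim1_two_sided x : (rk x).+1 = d -> exists P Q u, two_sided x P Q u.
Proof.
move=> xd; have [r r0 xr] := carrier_relint x.
have [u uu uV] : exists2 u, dot u u = 1 & forall w, w \in dir (carrier x) -> dot u w = 0.
  by apply: proper_vspace_unit_normal; rewrite -/(rk x) -xd.
have uV' w : w \in dir (carrier x) -> dot (- u) w = 0.
  by move=> /uV; rewrite dotNl => ->; rewrite oppr0.
have half v P c : (forall w, w \in dir (carrier x) -> dot v w = 0) -> T P -> P x ->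
    P c -> 0 < dot v (c - x) -> exists2 s : R, 0 < s &
    forall w, `|w| < s -> 0 <= dot v w -> P (x + w).
  move=> vV TP Px Pc vc; apply: (@half_ball _ _ _ (dir (carrier x)) _ r v (c - x)) => //.
  - exact: cell_convex.
  - by rewrite -/(rk x) xd.
  - by move=> w wV wr; apply: xr.
  - by rewrite addrC subrK.
have notboth P c c' : T P -> P x -> P c -> P c' -> 0 < dot u (c - x) ->
    dot u (c' - x) < 0 -> False.
  move=> TP Px Pc Pc' uc uc'.
  have [s s0 hs] := half u P c uV TP Px Pc uc.
  have [|s' s'0 hs'] := half (- u) P c' uV' TP Px Pc'.
    by rewrite dotNl oppr_gt0.
  have /(interior_rk TP) : P^° x.
    apply/nbhs_shiftP; exists (Num.min s s'); first by rewrite lt_min s0.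
    move=> w; rewrite lt_min => /andP[ws ws'].
    have [uw|uw] := leP 0 (dot u w); first exact: hs.
    by apply: hs' => //; rewrite dotNl oppr_ge0 ltW.
  by move: xd => /[swap] ->; lia.
have side v : (v = u \/ v = - u) -> exists P, [/\ T P, P x &
    exists2 c, P c & 0 < dot v (c - x)].
  move=> vu; have [e e0 xe] := cells_near x.
  have vv : dot v v = 1 by case: vu => ->; rewrite ?dotNl ?dotNr ?opprK.
  have [k k0 ke] := small_multiple v e0.
  have [P TP Pk] := cell_cover (x + k *: v).
  exists P; split => //; last first.
    by exists (x + k *: v) => //; rewrite addrC addKr dotZr vv mulr1.
  by apply: (xe (x + k *: v)) => //; rewrite addrC addKr.
have [Q [TQ Qx [q Qq uq]]] := side u (or_introl erefl).
have [P [TP Px [p Pp up]]] := side (- u) (or_intror erefl).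
have [s s0 hQ] := half u Q q uV TQ Qx Qq uq.
have [s' s'0 hP] := half (- u) P p uV' TP Px Pp up.
have over v S S' (e e' : R) : dot v v = 1 -> T S -> T S' -> 0 < e -> 0 < e' ->
    (forall w, `|w| < e -> 0 <= dot v w -> S (x + w)) ->
    (forall w, `|w| < e' -> 0 <= dot v w -> S' (x + w)) -> S = S'.
  move=> vv TS TS' e0 e'0 hS hS'.
  have m0 : 0 < Num.min e e' by rewrite lt_min e0.
  have [k k0] := small_multiple v m0; rewrite lt_min => /andP[ke ke'].
  apply: (@interior_cell_uniq _ _ (x + k *: v) TS TS'); last first.
    by apply: hS' => //; rewrite dotZr vv mulr1 ltW.
  have [C C0 vC] := dot_bound v.
  have ke0 : 0 < e - `|k *: v| by rewrite subr_gt0.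
  apply/nbhs_shiftP; exists (Num.min (e - `|k *: v|) (k / C)).
    by rewrite lt_min ke0 divr_gt0.
  move=> w; rewrite lt_min (ltr_pdivlMr _ _ C0) => /andP[we wC].
  rewrite -addrA; apply: hS; first by rewrite (le_lt_trans (ler_normD _ _))// -ltrBrDl.
  rewrite dotDr dotZr vv mulr1; have := ler_norm (- dot v w).
  by rewrite normrN; have := vC w; lra.
exists P, Q, u; split => //; last 2 first.
- by exists s' => // w ws uw; apply: hP; rewrite // dotNl oppr_ge0.
- by exists s.
move=> S TS Sx; have [c Sc cN] : exists2 c, S c & dot u (c - x) != 0.
  have [c Sc] := cell_interior TS.
  have [y Sy yN] := thin_avoid (@thin_hyperplane _ _ u (dot u x) (unit_neq0 uu)) Sc.
  by exists y => //; rewrite dotBr subr_eq0; apply/eqP.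
have [uc|uc] := ltP 0 (dot u (c - x)).
  have [e e0 he] := half u S c uV TS Sx Sc uc.
  by right; apply: (over u _ _ e s).
have uc' : 0 < dot (- u) (c - x) by rewrite dotNl oppr_gt0 lt_neqAle cN.
have [e e0 he] := half (- u) S c uV' TS Sx Sc uc'.
by left; apply: (over (- u) _ _ e s') => //; rewrite dotNl dotNr opprK.
Qed.

End TilingStructure.

(** * Facets *)

Section FacetStructure.
Variables (R : realType) (d : nat) (T : set (set 'rV[R]_d)).
Hypothesis tilingT : locally_finite_normal_tiling T.
Local Notation E := 'rV[R]_d.
Local Notation two_sided := (two_sided T).
Local Notation carrier := (carrier T).
Local Notation rk := (rk T).
Implicit Types (x y z a u v w : E) (P Q S F H : set E) (t : R).

Lemma ts_neq x P Q u : two_sided x P Q u -> P <> Q.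
Proof.
move=> ts PQ; have [r r0 hP] := ts_half1 ts; have [s s0 hQ] := ts_half2 ts.
have /(interior_rk tilingT (ts_cell1 ts)) : P^° x.
  apply/nbhs_shiftP; exists (Num.min r s); first by rewrite lt_min r0.
  move=> w; rewrite lt_min => /andP[wr ws].
  by have [uw|/ltW uw] := leP (dot u w) 0; [exact: hP|rewrite PQ; exact: hQ].
by have := ts_rk ts; lia.
Qed.

(** A point of Q on the other side would give Q both half balls. *)
Lemma ts_side2 x P Q u y : two_sided x P Q u -> Q y -> 0 <= dot u (y - x).
Proof.
move=> ts Qy; rewrite leNgt; apply/negP => uy.
have [r r0 xr] := carrier_relint tilingT x.
have [|||||||s s0 hs] := @half_ball _ _ Q (dir (carrier x)) x r (- u) (y - x).
- exact: (cell_convex tilingT (ts_cell2 ts)).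
- by rewrite -/(rk x) (ts_rk ts).
- by move=> w wV; rewrite dotNl (ts_normal ts)// oppr0.
- by [].
- by move=> w wV wr; apply: (xr w wV wr); [exact: ts_cell2 ts|exact: ts_mem2 ts].
- by rewrite addrC subrK.
- by rewrite dotNl oppr_gt0.
have [e e0 he] := ts_half2 ts.
have /(interior_rk tilingT (ts_cell2 ts)) : Q^° x.
  apply/nbhs_shiftP; exists (Num.min s e); first by rewrite lt_min s0.
  move=> w; rewrite lt_min => /andP[ws we].
  have [uw|uw] := leP 0 (dot u w); first exact: he.
  by apply: hs => //; rewrite dotNl oppr_ge0 ltW.
by have := ts_rk ts; lia.
Qed.

Lemma ts_side1 x P Q u y : two_sided x P Q u -> P y -> dot u (y - x) <= 0.
Proof. by move=> /two_sidedC/ts_side2/[apply]; rewrite dotNl oppr_ge0. Qed.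

Lemma ts_carrier x P Q u : two_sided x P Q u -> carrier x = P `&` Q.
Proof.
move=> ts; apply/seteqP; split=> y.
  by move=> xy; split; apply: xy;
    [exact: ts_cell1 ts|exact: ts_mem1 ts|exact: ts_cell2 ts|exact: ts_mem2 ts].
by move=> [Py Qy] S TS /(ts_only ts TS)[] ->.
Qed.

Lemma ts_directed_normal x P Q u : two_sided x P Q u -> directed_normal P Q u.
Proof.
move=> ts; rewrite /directed_normal -(ts_carrier ts).
split; first by split; [exact: ts_unit ts|apply/normal_to_dir/(ts_normal ts)].
move=> p xp; have up : dot u (p - x) = 0 by rewrite (ts_normal ts)// mem_dir.
have split_x y : dot u (y - p) = dot u (y - x).
  by rewrite -[LHS]addr0 -up -dotDr; congr dot; vec.
by split=> y; rewrite split_x; [exact: (ts_side1 ts)|exact: (ts_side2 ts)].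
Qed.

Lemma ts_interior1 x P Q u : two_sided x P Q u -> exists2 y, P y & dot u (y - x) < 0.
Proof.
move=> ts; have [r r0 hP] := ts_half1 ts.
have [k k0 kr] := small_multiple (- u) r0.
have uk : dot u (k *: - u) < 0.
  by rewrite dotZr dotNr (ts_unit ts) mulrN1 oppr_lt0.
by exists (x + k *: - u); [apply: hP => //; exact: ltW|rewrite addrC addKr].
Qed.

Lemma unit_normal_pm x P Q u n : two_sided x P Q u -> unit_normal n (P `&` Q) ->
  n = u \/ n = - u.
Proof.
move=> ts [nn /normal_to_dir nN]; rewrite -(ts_carrier ts) in nN.
have uu := ts_unit ts.
set w := n - dot n u *: u.
have uw : dot u w = 0 by rewrite /w dotBr dotZr uu mulr1 dotC subrr.
have wV : w \in dir (carrier x).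
  apply: (hyperplane_mem _ (unit_neq0 uu) (ts_normal ts) uw).
  by rewrite -/(rk x) (ts_rk ts).
have w0 : w = 0.
  by apply: dotxx_eq0; rewrite {1}/w dotBl dotZl uw mulr0 subr0 nN.
have nE : n = dot n u *: u by apply/eqP; rewrite -subr_eq0; apply/eqP.
move: nn; rewrite nE; set c := dot n u; rewrite !dotZl dotZr uu mulr1 => c1.
have /eqP : (c - 1) * (c + 1) = 0 by rewrite -[RHS](subrr (1 : R)) -{3}c1; ring.
rewrite mulf_eq0 subr_eq0 addr_eq0 => /orP[/eqP ->|/eqP ->].
  by left; rewrite scale1r.
by right; rewrite scaleN1r.
Qed.

Lemma directed_normal_uniq x P Q u u' : two_sided x P Q u ->
  directed_normal P Q u' -> u' = u.
Proof.
move=> ts [/(unit_normal_pm ts)[//|->] side].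
have [y Py uy] := ts_interior1 ts.
have [/(_ y Py) + _] := side x (conj (ts_mem1 ts) (ts_mem2 ts)).
by rewrite dotNl oppr_le0 leNgt uy.
Qed.

Lemma two_sided_of x P Q : (rk x).+1 = d -> T P -> T Q -> P x -> Q x -> P <> Q ->
  exists u, two_sided x P Q u.
Proof.
move=> xd TP TQ Px Qx PQ; have [P' [Q' [u ts]]] := codim1_two_sided tilingT xd.
have [PE|PE] := ts_only ts TP Px; have [QE|QE] := ts_only ts TQ Qx; subst P Q => //.
- by exists u.
- by exists (- u); exact: two_sidedC.
Qed.

(** The point x is inside a segment of the carrier through any given point. *)
Lemma carrier_sub_face x H P : T P -> is_face H P -> H x -> carrier x `<=` H.
Proof.
move=> TP fH Hx y xy; have [r r0 xr] := carrier_relint tilingT x.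
have yV : x - y \in dir (carrier x) by apply: mem_dir.
have Px : P x by case: fH Hx => a [b [_ ->]] [].
have [k k0 kr] := small_multiple (x - y) r0.
have k1 : 0 < 1 + k by rewrite addr_gt0.
have Pz : P (x + k *: (x - y)) by apply: (xr _ _ kr) => //; exact: memvZ.
have [//|||_ //] := face_extremal (t := k / (1 + k)) fH Pz (xy P TP Px).
- by rewrite divr_gt0.
- by rewrite ltr_pdivrMr// mul1r ltrDr.
- rewrite (_ : pt _ _ _ = x)//.
  by vecf; rewrite gt_eqF.
Qed.

(** The carrier lies in the hyperface, and both span the same hyperplane.  A second
    cell through x meets the first one in a face that a hyperplane cuts out; this
    hyperplane contains the carrier, hence also the hyperface. *)
Lemma hyperface_carrier H x : hyperface T H -> H x -> (d <= (rk x).+1)%N ->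
  (rk x).+1 = d /\ H = carrier x.
Proof.
move=> [P [k [TP fH /has_dimP[H0 Hk] kd]]] Hx dx.
have xH := carrier_sub_face TP fH Hx.
have Px : P x by case: fH Hx => a [b [_ ->]] [].
have dH := dir_mono xH; have := dimvS dH; rewrite -/(rk x) Hk => xk.
have xd : (rk x).+1 = d by lia.
split=> //; apply/seteqP; split=> // y Hy.
have dE : dir (carrier x) = dir H.
  by apply/eqP; rewrite -(geq_leqif (dimv_leqif_eq dH)) -/(rk x) Hk; lia.
have yx : y - x \in dir (carrier x) by rewrite dE mem_dir.
have Py : P y by case: fH Hy => a [b [_ ->]] [].
move=> Q TQ Qx; have [PQ|PQ] := pselect (P = Q); first by rewrite -PQ.
have [u ts] := two_sided_of xd TP TQ Px Qx PQ.
have [[a [b [_ PQE]]] _] := cells_meet_face tilingT TP TQ Px Qx.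
suff : (P `&` Q) y by case.
rewrite PQE; split=> //=.
have : (P `&` Q) x by []; rewrite PQE => -[_ /= <-].
apply/eqP; rewrite -subr_eq0 -dotBr; apply/eqP.
apply: (normal_to_dir a (carrier x)).1 yx => z z' xz xz'.
move: xz xz'; rewrite (ts_carrier ts) PQE => -[_ /= za] [_ /= za'].
by rewrite dotBr za za' subrr.
Qed.

Lemma codim1_hyperface x P Q u : two_sided x P Q u -> hyperface T (P `&` Q).
Proof.
move=> ts; exists P, (rk x); split.
- exact: ts_cell1 ts.
- by have [] := cells_meet_face tilingT (ts_cell1 ts) (ts_cell2 ts) (ts_mem1 ts) (ts_mem2 ts).
- by apply/has_dimP; rewrite -(ts_carrier ts); split => //; exists x.
- by rewrite addn1 (ts_rk ts).
Qed.

Lemma ts_adjacent x P Q u : two_sided x P Q u -> adjacent_cells P Q.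
Proof.
move=> ts; split; first exact: ts_neq ts.
have [f1 f2] := cells_meet_face tilingT (ts_cell1 ts) (ts_cell2 ts) (ts_mem1 ts) (ts_mem2 ts).
exists (P `&` Q), (rk x); split => //; last by rewrite addn1 (ts_rk ts).
by apply/has_dimP; rewrite -(ts_carrier ts); split => //; exists x.
Qed.

(** A relatively interior point x of the common facet has this facet as its
    carrier: any cell S through x meets P in a face that contains x, hence the
    facet. *)
Lemma adjacent_two_sided P Q : T P -> T Q -> adjacent_cells P Q ->
  exists x u, two_sided x P Q u.
Proof.
move=> TP TQ [PQ [H [k [fP fQ /has_dimP[[h Hh] Hk] kd]]]].
have HP y : H y -> P y by case: fP => a [b [_ ->]] [].
have HQ y : H y -> Q y by case: fQ => a [b [_ ->]] [].
have cPQ : is_convex (P `&` Q).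
  apply/is_convexP => y z t /andP[t0 t1] [Py Qy] [Pz Qz].
  by split; apply: pt_conv => //; exact: (cell_convex tilingT).
have [x [Px Qx] [r r0 xr]] : exists2 x, (P `&` Q) x & exists2 r : R, 0 < r &
    forall w, w \in dir (P `&` Q) -> `|w| < r -> (P `&` Q) (x + w).
  by apply: relint_ex => //; exists h; split; [exact: HP|exact: HQ].
exists x; apply: two_sided_of => //.
suff -> : rk x = \dim (dir (P `&` Q)).
  have := dimvS (dir_mono (_ : H `<=` P `&` Q)); rewrite Hk => /(_ _)/= kle.
  have {kle} kle : (k <= \dim (dir (P `&` Q)))%N.
    by apply: kle => y Hy; split; [exact: HP|exact: HQ].
  have := dim_leq (dir (P `&` Q)); rewrite leq_eqVlt => /orP[/eqP dPQ|]; last by lia.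
  have [q Pq] : (P `&` Q)^° !=set0.
    by apply: full_dim_interior => //; apply/has_dimP; split => //; exists x.
  exfalso; apply: PQ; apply: (interior_cell_uniq tilingT TP TQ (x := q)).
    by apply: filterS Pq => y [].
  by have /nbhs_singleton[] := Pq.
congr (\dim (dir _)); apply/seteqP; split=> y.
  by move=> xy; split; exact: xy.
move=> [Py Qy] S TS Sx.
have [fS _] := cells_meet_face tilingT TP TS Px Sx.
have yV : x - y \in dir (P `&` Q) by apply: mem_dir.
have [l l0 lr] := small_multiple (x - y) r0.
have l1 : 0 < 1 + l by rewrite addr_gt0.
have [Pz _] := xr _ (memvZ l yV) lr.
have [|||_ [_ //]] := face_extremal (t := l / (1 + l)) fS Pz Py.
- by rewrite divr_gt0.
- by rewrite ltr_pdivrMr// mul1r ltrDr.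
- rewrite (_ : pt _ _ _ = x)//.
  by vecf; rewrite gt_eqF.
Qed.

End FacetStructure.

(** * Generic points and segments *)

Section GenericPosition.
Variables (R : realType) (d : nat) (T : set (set 'rV[R]_d)).
Hypothesis tilingT : locally_finite_normal_tiling T.
Local Notation E := 'rV[R]_d.
Local Notation two_sided := (two_sided T).
Local Notation carrier := (carrier T).
Local Notation rk := (rk T).
Implicit Types (x y z a u v w p q : E) (P Q S F H O : set E) (t : R).

Lemma finite_cells (M : R) : finite_set [set P | T P /\ exists2 x, P x & `|x| <= M].
Proof.
pose K : set E := [set x | `|x| <= M].
have cK : compact K.
  apply: bounded_closed_compact.
    by exists M; split; [exact: num_real|move=> N MN x xK; exact: le_trans (ltW MN)].
  rewrite (_ : K = (fun x : E => `|x|) @^-1` [set r | r <= M])//.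
  apply: closed_comp; last exact: closed_le.
  by move=> x _; exact: norm_continuous.
have [_ lf _] := tilingT.
have /choice[U xU] : forall x, exists U : set E, nbhs x U /\
    finite_set [set P | T P /\ P `&` U !=set0].
  by move=> x; have [U] := lf x; exists U.
move: cK; rewrite compact_cover => /(_ E setT (fun x => (U x)^°)).
case=> [x _|x Kx|D _ KD]; first exact: open_interior.
  by exists x => //; have [/nbhs_interior/nbhs_singleton] := xU x.
have : finite_set (\bigcup_(x in [set` D]) [set P : set E | T P /\ P `&` U x !=set0]).
  by apply: bigcup_finite => // x _; have [] := xU x.
apply: sub_finite_set => P [TP [x Px /KD[y yD /interior_subset Uy]]].
by exists y => //; split => //; exists x.
Qed.

(** Write x for p + w + t (q - p) and let f be a point of its carrier.  Then q - p
    lies in the sum of the direction of the carrier, of W and of the line of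
    f - p.  If this sum is proper, q lies in a hyperplane through p; and only
    finitely many carriers meet the ball of radius M. *)
Lemma generic_thin p (W : {vspace E}) (M : R) : thin [set q | exists w t,
  [/\ w \in W, t != 0, `|p + w + t *: (q - p)| <= M &
      (rk (p + w + t *: (q - p)) + \dim W + 1 < d)%N]].
Proof.
have /finite_seqP[s sE] := finite_cells M.
pose F (A : {set 'I_(size s)}) : set E :=
  [set y | forall i, i \in A -> nth set0 s i y].
pose f A : E := xget 0 (F A).
pose V A : {vspace E} := (dir (F A) + W + <[(f A - p)%R]>)%VS.
pose B A : set E := [set q | (\dim (V A) < d)%N /\ q - p \in V A].
apply: (@thinS _ _ _ (\bigcup_A B A)); last first.
  apply: thin_bigcup => A; rewrite /B.
  have [Vd|Vd] := boolP (\dim (V A) < d)%N; last by exists [::] => // x [].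
  by apply: thinS (thin_subspace p Vd) => x [].
move=> q [w [t [wW t0]]]; set x := _ + _ => xM xd.
pose A : {set 'I_(size s)} := finset (fun i : 'I_(size s) => `[< nth set0 s i x >]).
have FA : F A = carrier x.
  apply/seteqP; split=> y.
    move=> Fy P TP Px; have : P \in s.
      suff : [set` s] P by []; rewrite -sE; split => //; exists x => //.
    move=> /(nthP set0)[i si PE]; rewrite -PE.
    by apply: (Fy (Ordinal si)); rewrite inE; apply/asboolP; rewrite /= PE.
  move=> xy i; rewrite inE => /asboolP Px; apply: xy => //.
  suff : [set P | T P /\ exists2 x, P x & `|x| <= M] (nth set0 s i) by case.
  by rewrite sE; apply: mem_nth.
have fx : carrier x (f A).
  by rewrite -FA; apply: (xgetPex (0 : E)); exists x; rewrite FA.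
exists A => //; split.
  apply: leq_ltn_trans xd; rewrite /V.
  apply: leq_trans (dimv_add_leqif _ _) _.
  apply: leq_add; last by rewrite dim_vline leq_b1.
  apply: leq_trans (dimv_add_leqif _ _) _.
  by rewrite FA.
rewrite -[q - p](scalerK t0) memvZ//.
rewrite (_ : _ *: _ = (x - f A) - w + (f A - p)); last first.
  by rewrite /x; vec.
apply: memv_add; last exact: memv_line.
by apply: memv_add; [rewrite FA mem_dir|rewrite memvN].
Qed.

Lemma generic_point p (W : {vspace E}) (M : R) q0 (U : set E) (B : set E) :
  thin B -> nbhs q0 U -> exists q, [/\ U q, ~ B q & forall w t, w \in W -> t != 0 ->
    `|p + w + t *: (q - p)| <= M -> (d <= rk (p + w + t *: (q - p)) + \dim W + 1)%N].
Proof.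
move=> thB q0U; have [q Uq qB] := thin_avoid (thinU thB (generic_thin p W M)) q0U.
exists q; split => //; first by move=> Bq; apply: qB; left.
move=> w t wW t0 wM; rewrite leqNgt; apply/negP => wd.
by apply: qB; right; exists w, t.
Qed.

(** Near a point of the segment only the one or two cells at this point occur; if
    the segment changes from P to Q there, it does so in the direction of the
    normal from P to Q. *)
Lemma walk (Rel : set E -> set E -> Prop) p q P Q :
  (forall P, Rel P P) -> (forall P Q S, Rel P Q -> Rel Q S -> Rel P S) ->
  (forall t, 0 <= t -> t <= 1 -> (d <= (rk (pt p q t)).+1)%N) ->
  (forall t P Q u, 0 <= t -> t <= 1 -> two_sided (pt p q t) P Q u ->
     0 <= dot u (q - p) -> Rel P Q) ->
  T P -> P p -> T Q -> Q q -> Rel P Q.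
Proof.
move=> Rrefl Rtrans generic step TP Pp TQ Qq.
have cous : forall P Q, T P -> T Q -> P (pt p q 0) -> Q (pt p q 1) -> Rel P Q; last first.
  by apply: cous => //; rewrite ?pt0 ?pt1.
refine (@cousin R (fun a b : R => forall P Q, T P -> T Q -> P (pt p q a) -> Q (pt p q b) -> Rel P Q) _ _).
  move=> a b c _ _ ab bc P' Q' TP' TQ' Pa Qc.
  have [S TS Sb] := cell_cover tilingT (pt p q b).
  by apply: (Rtrans _ S); [exact: ab|exact: bc].
move=> t t0 t1; have [e e0 te] := cells_near tilingT (pt p q t).
have D0 : 0 < 1 + `|q - p| by rewrite ltr_pwDl.
exists (e / (1 + `|q - p|)); first exact: divr_gt0.
move=> a b a0 b1 ab at_ tb ta bt P' Q' TP' TQ' Pa Qb.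
have ptB c : pt p q c - pt p q t = (c - t) *: (q - p) by vec.
have near c : `|c - t| < e / (1 + `|q - p|) -> `|pt p q c - pt p q t| < e.
  rewrite ptB normrZ ltr_pdivlMr//; have := normr_ge0 (q - p).
  by have := normr_ge0 (c - t); nra.
have Pt : P' (pt p q t).
  by apply: te TP' Pa; apply: near; rewrite ltr_norml; apply/andP; split; lra.
have Qt : Q' (pt p q t).
  by apply: te TQ' Qb; apply: near; rewrite ltr_norml; apply/andP; split; lra.
have [<-//|PQ] := pselect (P' = Q').
have := generic t t0 t1; rewrite leq_eqVlt => /orP[/eqP/esym td|]; last first.
  rewrite ltnS => td; exfalso; apply: PQ.
  by apply: (interior_cell_uniq tilingT TP' TQ' _ Qt); exact: (rk_interior tilingT).
have [u ts] := two_sided_of tilingT td TP' TQ' Pt Qt PQ.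
apply: (step t P' Q' u) => //.
have := ts_side2 tilingT ts Qb; have := ts_side1 tilingT ts Pa.
rewrite !ptB !dotZr => ua ub.
have [tb'|tb'] := ltP t b; first by rewrite pmulr_rge0 ?subr_gt0 in ub.
have at' : a < t by lra.
by rewrite nmulr_rle0 ?subr_lt0 in ua.
Qed.

(** A generic segment inside O crosses the tiling only at points of codimension
    at most one. *)
Lemma cells_connected (Rel : set E -> set E -> Prop) O P Q p q :
  (forall P, Rel P P) -> (forall P Q S, Rel P Q -> Rel Q S -> Rel P S) ->
  is_convex O -> open O ->
  (forall x P Q u, O x -> two_sided x P Q u -> Rel P Q) ->
  T P -> P^° p -> O p -> T Q -> Q^° q -> O q -> Rel P Q.
Proof.
move=> Rrefl Rtrans cO oO step TP Pp Op TQ Qq Oq.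
pose U := Q^° `&` O `&` [set y : E | `|y| < 1 + `|q|].
have qU : nbhs q U.
  apply: filterI; first by apply: filterI; [exact: nbhs_interior|exact: open_nbhs_nbhs].
  apply/nbhs_shiftP; exists 1 => // w w1 /=.
  by rewrite (le_lt_trans (ler_normD _ _))// addrC ltrD2r.
have thin0 : thin (set0 : set E) by exists [::].
have [q' [[[Qq' Oq'] q'M] _ q'g]] :=
  generic_point p 0%VS (`|p| + (1 + `|q|)) thin0 qU.
apply: (@walk Rel p q') => //; try by apply: interior_subset.
- move=> t t0 t1; have [->|tN] := eqVneq t 0.
    by rewrite pt0 (interior_rk tilingT TP Pp) leqnSn.
  have := q'g 0 t (mem0v _) tN; rewrite dimv0 addn0 addn1 addr0; apply.
  rewrite -/(pt p q' t) ptE (le_trans (ler_normD _ _))// !normrZ ger0_norm ?subr_ge0//.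
  rewrite ger0_norm//; have := normr_ge0 p; have := normr_ge0 q'; move: q'M => /=; nra.
- move=> t P' Q' u t0 t1 ts _; apply: (step _ _ _ _ _ ts).
  exact: pt_conv.
Qed.

End GenericPosition.

(** * Consistent families and gluing *)

Section Gluing.
Variables (R : realType) (d : nat) (T : set (set 'rV[R]_d)) (s : set 'rV[R]_d -> R).
Hypothesis tilingT : locally_finite_normal_tiling T.
Local Notation E := 'rV[R]_d.
Local Notation two_sided := (two_sided T).
Implicit Types (x y z u v w p q : E) (P Q S F H O K M C : set E) (t : R).
Implicit Types (l : set E -> E * R).

Definition affine_value (f : E * R) x := dot f.1 x + f.2.

(** The affine function that vanishes on the hyperplane through x with normal u
    and has gradient s (P `&` Q) *: u. *)
Definition jump P Q u x : E * R := (s (P `&` Q) *: u, - (s (P `&` Q) * dot u x)).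

Lemma affine_valueD f g x : affine_value (f + g) x = affine_value f x + affine_value g x.
Proof. by rewrite /affine_value /= dotDl; ring. Qed.

Lemma jump_value P Q u x y : affine_value (jump P Q u x) y = s (P `&` Q) * dot u (y - x).
Proof. by rewrite /affine_value /= dotZl dotBr; ring. Qed.

(** Families are indexed by all sets; only their values on cells matter. *)
Definition consistent l C := forall x P Q u, C x -> two_sided x P Q u ->
  l Q = l P + jump P Q u x.

Definition thick K (e : R) := [set x | exists2 k, K k & `|x - k| < e].

(** The jumps have no monodromy on a neighbourhood of K. *)
Definition trivial_near K := exists2 e : R, 0 < e & exists l, consistent l (thick K e).

Lemma consistentS l C C' : C `<=` C' -> consistent l C' -> consistent l C.
Proof. by move=> CC' lC x P Q u /CC'; exact: lC. Qed.

Lemma consistent_shift l C c : consistent l C -> consistent (fun P => l P + c) C.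
Proof. by move=> lC x P Q u Cx ts; rewrite (lC _ _ _ _ Cx ts) addrAC. Qed.

Lemma thick_sub K K' e e' : K `<=` K' -> e <= e' -> thick K e `<=` thick K' e'.
Proof. by move=> KK' ee' x [k /KK' Kk xk]; exists k => //; exact: lt_le_trans ee'. Qed.

Lemma sub_thick K e : 0 < e -> K `<=` thick K e.
Proof. by move=> e0 x Kx; exists x => //; rewrite subrr normr0. Qed.

Lemma thick_open K e : open (thick K e).
Proof.
rewrite openE => x [k Kk xk]; apply/nbhs_shiftP; exists (e - `|x - k|); first by rewrite subr_gt0.
move=> w we; exists k => //; rewrite addrAC (le_lt_trans (ler_normD _ _))//.
by rewrite -ltrBrDl.
Qed.

Lemma pt_near x y x' y' t e : 0 <= t -> t <= 1 -> `|x - x'| < e -> `|y - y'| < e ->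
  `|pt x y t - pt x' y' t| < e.
Proof.
move=> t0 t1 xe ye; rewrite (_ : _ - _ = (1 - t) *: (x - x') + t *: (y - y')); last by vec.
rewrite (le_lt_trans (ler_normD _ _))// !normrZ !ger0_norm ?subr_ge0//.
have [->|tN] := eqVneq t 0; first by rewrite subr0 mul1r mul0r addr0.
by have t0' : 0 < t; [rewrite lt_neqAle eq_sym tN|nra].
Qed.

Lemma thick_convex K e : is_convex K -> is_convex (thick K e).
Proof.
move=> cK; apply/is_convexP => x y t /andP[t0 t1] [k Kk xk] [k' Kk' yk].
by exists (pt k k' t); [exact: pt_conv|exact: pt_near].
Qed.

Lemma trivial_nearS K K' : K `<=` K' -> trivial_near K' -> trivial_near K.
Proof.
move=> KK' [e e0 [l lK]]; exists e => //; exists l.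
by apply: consistentS lK; exact: thick_sub.
Qed.

Lemma consistent_diff l l' O P Q p q : is_convex O -> open O ->
  consistent l O -> consistent l' O ->
  T P -> P^° p -> O p -> T Q -> Q^° q -> O q -> l P - l' P = l Q - l' Q.
Proof.
move=> cO oO lO l'O TP Pp Op TQ Qq Oq.
apply: (@cells_connected _ _ _ tilingT (fun P Q => l P - l' P = l Q - l' Q) O P Q p q) => //.
  by move=> P1 P2 P3 ->.
move=> x P' Q' u Ox ts; rewrite (lO _ _ _ _ Ox ts) (l'O _ _ _ _ Ox ts).
by rewrite opprD addrACA subrr addr0.
Qed.

(** On the cells that meet the convex set M the two families differ by a
    constant, which can be subtracted; a cell that meets both K1 and K2 meets
    M, by convexity. *)
Lemma glue K1 K2 M : is_convex M -> M !=set0 -> M `<=` K1 -> M `<=` K2 ->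
  (forall k1 k2, K1 k1 -> K2 k2 -> exists t, [/\ 0 <= t, t <= 1 & M (pt k1 k2 t)]) ->
  trivial_near K1 -> trivial_near K2 -> trivial_near (K1 `|` K2).
Proof.
move=> cM [m Mm] MK1 MK2 cross [e1 e1_gt0 [l1 l1K]] [e2 e2_gt0 [l2 l2K]].
pose e := Num.min e1 e2.
have e0 : 0 < e by rewrite lt_min e1_gt0.
have {}l1K : consistent l1 (thick K1 e).
  by apply: consistentS l1K; apply: thick_sub; rewrite // ge_min lexx.
have {}l2K : consistent l2 (thick K2 e).
  by apply: consistentS l2K; apply: thick_sub; rewrite // ge_min lexx orbT.
have [P0 TP0 P0m] := cell_cover tilingT m.
have openM := @thick_open M e.
have [p0 P0p0 Mp0] : exists2 p, P0^° p & thick M e p.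
  by apply: (cell_dense tilingT TP0 P0m); apply: open_nbhs_nbhs; split => //; exact: sub_thick.
pose c := l1 P0 - l2 P0.
have same P p : T P -> P^° p -> thick M e p -> l1 P = l2 P + c.
  move=> TP Pp Mp; apply/eqP; rewrite addrC -subr_eq; apply/eqP.
  apply: (@consistent_diff _ _ (thick M e) _ _ p p0) => //; first exact: thick_convex.
    by apply: consistentS l1K; exact: thick_sub.
  by apply: consistentS l2K; exact: thick_sub.
pose l P := if `[< exists2 p, P^° p & thick K1 e p >] then l1 P else l2 P + c.
exists e => //; exists l.
have meets K x P : T P -> P x -> thick K e x -> exists2 p, P^° p & thick K e p.
  move=> TP Px Kx; apply: (cell_dense tilingT TP Px).
  by apply: open_nbhs_nbhs; split => //; exact: thick_open.
have lE1 P x : T P -> P x -> thick K1 e x -> l P = l1 P.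
  by move=> TP Px Kx; rewrite /l; case: asboolP => // -[]; exact: meets Kx.
have lE2 P x : T P -> P x -> thick K2 e x -> l P = l2 P + c.
  move=> TP Px Kx; rewrite /l; case: asboolP => // -[p Pp [k1 Kk1 pk1]].
  have [q Pq [k2 Kk2 qk2]] := meets _ _ _ TP Px Kx.
  have [t [t0 t1 Mt]] := cross _ _ Kk1 Kk2.
  apply: (same P (pt p q t)) => //; last first.
    by exists (pt k1 k2 t) => //; exact: pt_near.
  have [->|tN] := eqVneq t 0; first by rewrite pt0.
  apply: segment_interior => //; first exact: (cell_convex tilingT).
    exact: interior_subset.
  by rewrite lt_neqAle eq_sym tN.
move=> x P Q u [k [Kk|Kk] xk] ts.
  have Kx : thick K1 e x by exists k.
  rewrite (lE1 P x (ts_cell1 ts) (ts_mem1 ts) Kx) (lE1 Q x (ts_cell2 ts) (ts_mem2 ts) Kx).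
  exact: l1K.
have Kx : thick K2 e x by exists k.
rewrite (lE2 P x (ts_cell1 ts) (ts_mem1 ts) Kx) (lE2 Q x (ts_cell2 ts) (ts_mem2 ts) Kx).
exact: (consistent_shift c l2K).
Qed.

Lemma trivial_ball x e l K : 0 < e -> (forall k, K k -> `|k - x| < e / 2) ->
  consistent l (thick [set x] e) -> trivial_near K.
Proof.
move=> e0 Kx lx; exists (e / 2); first exact: divr_gt0.
exists l; apply: consistentS lx => y [k /Kx kx yk]; exists x => //.
rewrite (_ : y - x = (y - k) + (k - x)); last by vec.
by rewrite (le_lt_trans (ler_normD _ _))//; lra.
Qed.

Definition seg x y (a b : R) : set E := [set z | exists t, [/\ a <= t, t <= b & z = pt x y t]].

Lemma pt_pt x y a b t : pt (pt x y a) (pt x y b) t = pt x y (a + t * (b - a)).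
Proof. vec. Qed.

Lemma seg_convex x y a b : is_convex (seg x y a b).
Proof.
apply/is_convexP => _ _ t /andP[t0 t1] [r [ar rb ->]] [r' [ar' rb' ->]].
exists (r + t * (r' - r)); split; last by rewrite pt_pt.
  nra.
nra.
Qed.

Lemma trivial_segment x y :
  (forall t, 0 <= t -> t <= 1 -> trivial_near [set pt x y t]) ->
  trivial_near (seg x y 0 1).
Proof.
move=> loc; refine (@cousin R (fun a b => trivial_near (seg x y a b)) _ _).
  move=> a b c ab bc tab tbc.
  apply: (@trivial_nearS _ (seg x y a b `|` seg x y b c)).
    move=> _ [t [at_ tc ->]].
    by have [tb|bt] := leP t b; [left|right]; exists t; split => //; exact: ltW.
  apply: (@glue _ _ [set pt x y b]) => //.
  - by apply/is_convexP => _ _ t _ -> ->; rewrite /= /pt subrr scaler0 addr0.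
  - by exists (pt x y b).
  - by move=> _ ->; exists b; rewrite lexx ltW.
  - by move=> _ ->; exists b; rewrite lexx ltW.
  move=> _ _ [r [ar rb ->]] [r' [br' rc ->]].
  have [rE|rN] := eqVneq r b.
    by exists 0; split => //; rewrite rE pt0.
  have rb' : r < b by rewrite lt_neqAle rN.
  have rr' : 0 < r' - r by lra.
  exists ((b - r) / (r' - r)); split.
  - by apply: divr_ge0; lra.
  - by rewrite ler_pdivrMr//; lra.
  - by rewrite pt_pt divfK ?gt_eqF// addrC subrK.
move=> t t0 t1; have [e e0 [l lt]] := loc t t0 t1.
have D0 : 0 < 1 + `|y - x| by rewrite ltr_pwDl.
exists (e / 2 / (1 + `|y - x|)); first by rewrite !divr_gt0.
move=> a b a0 b1 ab at_ tb ta bt; apply: (trivial_ball e0 _ lt).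
move=> _ [r [ar rb ->]]; rewrite (_ : _ - _ = (r - t) *: (y - x)); last by vec.
have : `|r - t| < e / 2 / (1 + `|y - x|).
  by rewrite ltr_norml; apply/andP; split; lra.
rewrite normrZ ltr_pdivlMr//; have := normr_ge0 (y - x).
by have := normr_ge0 (r - t); nra.
Qed.

(** The part of the triangle x y z cut out by the rays from x to the points of
    the segment from pt y z a to pt y z b. *)
Definition tri x y z (a b : R) : set E :=
  [set w | exists t r, [/\ a <= t <= b, 0 <= r <= 1 & w = pt x (pt y z t) r]].

(** The triangle is swept by the segments from x to the opposite side. *)
Lemma trivial_triangle x y z :
  (forall t, 0 <= t -> t <= 1 -> trivial_near (seg x (pt y z t) 0 1)) ->
  trivial_near (tri x y z 0 1).
Proof.
move=> loc; refine (@cousin R (fun a b => trivial_near (tri x y z a b)) _ _).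
  move=> a b c ab bc tab tbc.
  apply: (@trivial_nearS _ (tri x y z a b `|` tri x y z b c)).
    move=> _ [t [r [/andP[at_ tc] r01 ->]]].
    by have [tb|bt] := leP t b; [left|right]; exists t, r; split => //;
      apply/andP; split => //; exact: ltW.
  apply: (@glue _ _ (seg x (pt y z b) 0 1)) => //.
  - exact: seg_convex.
  - by exists (pt x (pt y z b) 0), 0; rewrite ler01 lexx.
  - by move=> _ [r [r0 r1 ->]]; exists b, r; rewrite lexx ltW// r0.
  - by move=> _ [r [r0 r1 ->]]; exists b, r; rewrite lexx ltW// r0.
  move=> _ _ [t [r [/andP[at_ tb] /andP[r0 r1] ->]]] [t' [r' [/andP[bt' tc] /andP[r'0 r'1] ->]]].
  set A := r * (b - t); set B := r' * (t' - b).
  have A0 : 0 <= A by rewrite mulr_ge0// subr_ge0.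
  have B0 : 0 <= B by rewrite mulr_ge0// subr_ge0.
  have [AE|AN] := eqVneq A 0.
    exists 0; split => //; rewrite pt0; exists r; split => //.
    rewrite /pt; apply/rowP => i; rewrite !mxE; apply/eqP; rewrite -subr_eq0; apply/eqP.
    by transitivity (- A * (z 0 i - y 0 i)); [rewrite /A; ring|rewrite AE oppr0 mul0r].
  have A1 : 0 < A by rewrite lt_neqAle eq_sym AN.
  have AB : 0 < A + B by rewrite ltr_pwDl.
  (* The barycentric weight that balances the signed distances to the ray
     through the intermediate vertex. *)
  pose k := A / (A + B).
  have k0 : 0 <= k by rewrite divr_ge0// ltW.
  have k1 : k <= 1 by rewrite ler_pdivrMr// mul1r lerDl.
  exists k; split => //; exists (r + k * (r' - r)); split; [nra|nra|].
  have kE : k * (A + B) = A by rewrite divfK// gt_eqF.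
  rewrite /pt; apply/rowP => i; rewrite !mxE; apply/eqP; rewrite -subr_eq0; apply/eqP.
  transitivity ((k * (A + B) - A) * (z 0 i - y 0 i)); last by rewrite kE subrr mul0r.
  by rewrite /A /B; ring.
move=> t t0 t1; have [e e0 [l lt]] := loc t t0 t1.
have D0 : 0 < 1 + `|z - y| by rewrite ltr_pwDl.
exists (e / 2 / (1 + `|z - y|)); first by rewrite !divr_gt0.
move=> a b a0 b1 ab at_ tb ta bt; exists (e / 2); first exact: divr_gt0.
exists l; apply: consistentS lt => w [_ [t' [r [/andP[at' tb'] /andP[r0 r1] ->]]] wk].
exists (pt x (pt y z t) r); first by exists r.
rewrite (_ : w - _ = (w - pt x (pt y z t') r) + (r * (t' - t)) *: (z - y)); last by vec.
rewrite (le_lt_trans (ler_normD _ _))// normrZ.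
have : `|r * (t' - t)| < e / 2 / (1 + `|z - y|).
  rewrite normrM ger0_norm//.
  have : `|t' - t| < e / 2 / (1 + `|z - y|).
    by rewrite ltr_norml; apply/andP; split; lra.
  by have := normr_ge0 (t' - t); nra.
rewrite ltr_pdivlMr//; have := normr_ge0 (z - y).
by have := normr_ge0 (r * (t' - t)); nra.
Qed.

End Gluing.

(** * Rays around a face of codimension two *)

Section Winding.
Variable R : realType.
Implicit Types A B C X Y Z : R.

(** The signed crossing of a segment from a to b with a ray from the origin:
    A and B are the coordinates of a and b along the left normal of the ray,
    and Z is the cross product of a and b. *)
Definition crossing A B Z : R :=
  if [&& A < 0, 0 < B & 0 < Z] then 1
  else if [&& 0 < A, B < 0 & Z < 0] then -1 else 0.

(** The winding number around the origin of the triangle a b c, where X, Y and Z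
    are the cross products of b and c, of c and a, and of a and b. *)
Definition winding X Y Z : R :=
  if [&& 0 < X, 0 < Y & 0 < Z] then 1
  else if [&& X < 0, Y < 0 & Z < 0] then -1 else 0.

Lemma crossingN A B Z : crossing B A (- Z) = - crossing A B Z.
Proof.
rewrite /crossing oppr_gt0 oppr_lt0.
by case: (ltgtP A 0) => _; case: (ltgtP B 0) => _; case: (ltgtP Z 0) => _;
  rewrite /= ?opprK ?oppr0.
Qed.

(** A triangle crosses every ray from the origin equally often.  The hypothesis is
    the linear relation between three vectors of the plane; it excludes the
    patterns of signs for which the two sides differ. *)
Lemma crossing_sum A B C X Y Z :
  A != 0 -> B != 0 -> C != 0 -> X != 0 -> Y != 0 -> Z != 0 ->
  A * X + B * Y + C * Z = 0 ->
  crossing A B Z + crossing B C X + crossing C A Y = winding X Y Z.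
Proof.
move=> A0 B0 C0 X0 Y0 Z0; rewrite /crossing /winding.
case: (ltgtP A 0) A0 => // hA _; case: (ltgtP B 0) B0 => // hB _;
case: (ltgtP C 0) C0 => // hC _; case: (ltgtP X 0) X0 => // hX _;
case: (ltgtP Y 0) Y0 => // hY _; case: (ltgtP Z 0) Z0 => // hZ _ eq0 /=;
first [by ring|exfalso; nra].
Qed.

End Winding.

Section Rays.
Variables (R : realType) (d : nat) (T : set (set 'rV[R]_d)).
Hypothesis tilingT : locally_finite_normal_tiling T.
Local Notation E := 'rV[R]_d.
Local Notation two_sided := (two_sided T).
Local Notation carrier := (carrier T).
Local Notation rk := (rk T).
Implicit Types (x y z a u v w p q n h e : E) (P Q S F H O K M C : set E) (t : R).

Lemma face_cap F G P : is_face F P -> is_face G P -> is_face (F `&` G) P.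
Proof.
move=> [a [b [Pa ->]]] [a' [b' [Pa' ->]]]; exists (a + a'), (b + b'); split.
  by move=> x Px; rewrite dotDl lerD ?Pa ?Pa'.
apply/seteqP; split=> x /=.
  by move=> [[Px /= xa] [_ /= xa']]; split => //=; rewrite dotDl xa xa'.
move=> [Px]; rewrite /= dotDl => E1; have := Pa _ Px; have := Pa' _ Px.
by split; split => //; lra.
Qed.

Lemma finite_cells_at x : finite_set [set P | T P /\ P x].
Proof.
apply: (sub_finite_set _ (finite_cells tilingT `|x|)) => P [TP Px].
by split => //; exists x.
Qed.

(** The sum of supporting functionals of finitely many faces supports their
    intersection. *)
Lemma carrier_face x P : T P -> P x -> is_face (carrier x) P.
Proof.
move=> TP Px; have /finite_seqP[s sE] := finite_cells_at x.
suff : forall s' : seq (set E), {subset s' <= s} ->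
    is_face (P `&` [set y | forall Q, Q \in s' -> Q y]) P.
  move=> /(_ s (fun _ => id)); rewrite (_ : P `&` _ = carrier x)//.
  apply/seteqP; split=> y.
    move=> [Py sy] Q TQ Qx; apply: sy.
    by suff : [set` s] Q by []; rewrite -sE.
  move=> xy; split; first exact: xy.
  move=> Q Qs; have : [set` s] Q by [].
  by rewrite -sE => -[TQ Qx]; exact: xy.
elim=> [_|Q s' IH ss'].
  exists 0, 0; split=> [x' _|]; first by rewrite dot0l.
  by apply/seteqP; split=> y [Py _]; split => //=; rewrite dot0l.
have : [set` s] Q by apply: ss'; rewrite mem_head.
rewrite -sE => -[TQ Qx]; have [fQ _] := cells_meet_face tilingT TP TQ Px Qx.
have fs' : is_face (P `&` [set y | forall Q, Q \in s' -> Q y]) P.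
  by apply: IH => S Ss'; apply: ss'; rewrite in_cons Ss' orbT.
rewrite (_ : P `&` _ = (P `&` Q) `&` (P `&` [set y | forall Q, Q \in s' -> Q y])).
  exact: face_cap.
apply/seteqP; split=> y.
  move=> [Py sy]; split; split => //; first by apply: sy; rewrite mem_head.
  by move=> S Ss'; apply: sy; rewrite in_cons Ss' orbT.
move=> [[Py Qy] [_ sy]]; split => // S; rewrite in_cons => /orP[/eqP -> //|].
exact: sy.
Qed.

Definition hyperfaces_around z := [set H | hyperface T H /\ carrier z `<=` H].

Section Ray.
Variables (z u v : E).
Hypothesis zd : ((rk z).+2 = d)%N.
Hypothesis frame : normal_frame (carrier z) u v.

Definition cross a b := dot u a * dot v b - dot v a * dot u b.

(** The unit vector that the quarter turn from u to v takes to n. *)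
Definition turned_back n := dot v n *: u - dot u n *: v.

Let uu : dot u u = 1. Proof. by case: frame => -[]. Qed.
Let vv : dot v v = 1. Proof. by case: frame => _ []. Qed.
Let uv : dot u v = 0. Proof. by case: frame. Qed.
Let uN w : w \in dir (carrier z) -> dot u w = 0.
Proof. by case: frame => -[_ /normal_to_dir + _ _]; exact. Qed.
Let vN w : w \in dir (carrier z) -> dot v w = 0.
Proof. by case: frame => _ [_ /normal_to_dir + _]; exact. Qed.

Lemma mem_carrier_dir w : dot u w = 0 -> dot v w = 0 -> w \in dir (carrier z).
Proof.
by move=> uw vw; apply: (codim2_mem _ uu vv uv) => //; rewrite -/(rk z) zd.
Qed.

Lemma frame_decomp n : (forall w, w \in dir (carrier z) -> dot n w = 0) ->
  n = dot u n *: u + dot v n *: v.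
Proof.
move=> nN; set m := _ + _; apply/eqP; rewrite -subr_eq0; apply/eqP.
have um : dot u (n - m) = 0.
  by rewrite /m dotBr dotDr !dotZr uu uv; ring.
have vm : dot v (n - m) = 0.
  by rewrite /m dotBr dotDr !dotZr vv (dotC v u) uv; ring.
apply: dotxx_eq0; have nm := mem_carrier_dir um vm.
by rewrite dotBl (nN _ nm) /m dotDl !dotZl um vm; ring.
Qed.

Lemma dot_turned_back n a : dot (turned_back n) a = dot v n * dot u a - dot u n * dot v a.
Proof. by rewrite /turned_back dotBl !dotZl. Qed.

Section UnitNormal.
Variable n : E.
Hypotheses (nn : dot n n = 1) (nN : forall w, w \in dir (carrier z) -> dot n w = 0).
Let h := turned_back n.

Let dot_n a : dot n a = dot u n * dot u a + dot v n * dot v a.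
Proof. by rewrite {1}(frame_decomp nN) dotDl !dotZl. Qed.

Let unit_coords : dot u n * dot u n + dot v n * dot v n = 1.
Proof. by rewrite -dot_n. Qed.

Lemma turned_back_unit : dot h h = 1.
Proof.
rewrite dot_turned_back /h /turned_back !dotBr !dotZr uu vv (dotC v u) uv.
by rewrite !(mulr1, mulr0) subr0 sub0r mulrN opprK addrC.
Qed.

Lemma turned_back_orth : dot n h = 0.
Proof. by rewrite dotC dot_turned_back mulrC subrr. Qed.

Lemma turned_back_normal w : w \in dir (carrier z) -> dot h w = 0.
Proof. by move=> wV; rewrite dot_turned_back (uN wV) (vN wV) !mulr0 subrr. Qed.

Lemma cross_turned_back a b : cross a b = dot h a * dot n b - dot n a * dot h b.
Proof.
rewrite /h !dot_turned_back !dot_n.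
transitivity ((dot u n * dot u n + dot v n * dot v n) * cross a b).
  by rewrite unit_coords mul1r.
by rewrite /cross; ring.
Qed.

Lemma mem_carrier_dir_turned a : dot n a = 0 -> dot h a = 0 -> a \in dir (carrier z).
Proof.
move=> na ha; apply: (codim2_mem _ nn turned_back_unit turned_back_orth nN) => //.
  by rewrite -/(rk z) zd.
exact: turned_back_normal.
Qed.

End UnitNormal.

Lemma hyperface_dir H : hyperface T H -> (\dim (dir H)).+1 = d.
Proof. by move=> [P [k [_ _ /has_dimP[_ ->] <-]]]; rewrite addn1. Qed.

(** The hyperface H lies on one side of the face that it contains, because a
    hyperplane supports a cell along this face. *)
Lemma turning_normal_spec H : hyperfaces_around z H ->
  let n := turning_normal u v (carrier z) H in
  [/\ dot n n = 1, normal_to n H &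
    forall p x, carrier z p -> H x -> ~ carrier z x -> 0 < dot (turned_back n) (x - p)].
Proof.
move=> [hH zH] n.
have dFH := subvP (dir_mono zH).
have [n0 n0n0 n0H] : exists2 n, dot n n = 1 & forall w, w \in dir H -> dot n w = 0.
  by apply: proper_vspace_unit_normal; have := hyperface_dir hH; lia.
have n0N w : w \in dir (carrier z) -> dot n0 w = 0 by move=> /dFH /n0H.
have [P [k [TP fH _ _]]] := hH.
have HP y : H y -> P y by case: fH => a [b [_ ->]] [].
have [a [b [Pa FE]]] := carrier_face TP (HP _ (zH z (@carrier_refl _ _ _ z))).
have aN : forall w, w \in dir (carrier z) -> dot a w = 0.
  apply/normal_to_dir => p p'; rewrite FE => -[_ /= pa] [_ /= pa'].
  by rewrite dotBr pa pa' subrr.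
set h0 := turned_back n0.
have ac p x : carrier z p -> H x -> dot a (x - p) = dot h0 (x - p) * dot a h0.
  move=> zp Hx; have n0x : dot n0 (x - p) = 0 by rewrite n0H// mem_dir//; exact: zH.
  apply/eqP; rewrite -subr_eq0 -dotZr -dotBr; apply/eqP/aN.
  apply: (mem_carrier_dir_turned n0n0 n0N).
    by rewrite dotBr dotZr (turned_back_orth n0) n0x mulr0 subrr.
  by rewrite dotBr dotZr (turned_back_unit n0n0 n0N) mulr1 subrr.
have neg p x : carrier z p -> H x -> ~ carrier z x -> dot h0 (x - p) * dot a h0 < 0.
  move=> zp Hx zx; rewrite -ac// dotBr subr_lt0.
  have pa : dot a p = b by move: zp; rewrite FE => -[].
  rewrite pa lt_neqAle Pa ?andbT; last exact: HP.
  by apply/eqP => xa; apply: zx; rewrite FE; split => //; exact: HP.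
suff : exists n, [set n | unit_normal n H /\ forall p x, carrier z p -> H x -> ~ carrier z x ->
    0 < dot u (x - p) * dot v n - dot v (x - p) * dot u n] n.
  move=> /(xgetPex 0); rewrite -/(turning_normal u v (carrier z) H) -/n => -[[nn nH] side].
  split => // p x zp Hx zx; rewrite dot_turned_back.
  by have := side p x zp Hx zx; rewrite mulrC [X in _ - X]mulrC.
have [ah|ah] := ltP (dot a h0) 0.
  exists n0; split; first by split => //; apply/normal_to_dir.
  move=> p x zp Hx zx; rewrite mulrC [X in _ - X]mulrC -dot_turned_back.
  by have := neg p x zp Hx zx; rewrite nmulr_llt0.
exists (- n0); split.
  split; first by rewrite dotNl dotNr opprK.
  by apply/normal_to_dir => w /n0H; rewrite dotNl => ->; rewrite oppr0.
move=> p x zp Hx zx; rewrite mulrC [X in _ - X]mulrC -dot_turned_back.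
have -> : turned_back (- n0) = - h0 by rewrite /h0 /turned_back !dotNr; vec.
have := neg p x zp Hx zx; rewrite dotNl; nra.
Qed.

(** The hyperface contains a disc of the face and a point beyond it, hence the half
    disc that they span at z. *)
Lemma hyperface_ray H : hyperfaces_around z H ->
  let n := turning_normal u v (carrier z) H in
  exists2 r : R, 0 < r & forall a, `|a| < r -> dot n a = 0 ->
    0 < dot (turned_back n) a -> H (z + a).
Proof.
move=> HH n; have [nn nH side] := turning_normal_spec HH; rewrite -/n in nn nH side.
case: HH => hH zH; set h := turned_back n in side *.
have nN w : w \in dir (carrier z) -> dot n w = 0.
  by move=> /(subvP (dir_mono zH)); exact: (normal_to_dir n H).1.
have cH : is_convex H.
  case: hH => P [k [TP [a [b [_ ->]]] _ _]]; apply/is_convexP.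
  move=> x y t /andP[t0 t1] [Px /= xa] [Py /= ya]; split.
    by apply: pt_conv => //; exact: (cell_convex tilingT).
  by rewrite /= /pt dotDr dotZr dotBr xa ya; ring.
have [x Hx zx] : exists2 x, H x & ~ carrier z x.
  apply: contrapT => noH; have : H `<=` carrier z.
    by move=> x Hx; apply: contrapT => zx; apply: noH; exists x.
  move=> /dir_mono/dimvS; have := hyperface_dir hH; rewrite -/(rk z); lia.
have [r r0 zr] := carrier_relint tilingT z.
set e := x - z; have he : 0 < dot h e by apply: side.
have ne : dot n e = 0 by apply: nH => //; exact: zH.
have [C C0 hC] := dot_bound h.
pose D := 1 + C / dot h e * `|e|.
have D0 : 0 < D by rewrite ltr_pwDl// !mulr_ge0// ?invr_ge0 ltW.
exists (Num.min (r / 2 / D) (dot h e / 2 / C)).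
  by rewrite lt_min !divr_gt0.
move=> a; rewrite lt_min (ltr_pdivlMr _ _ D0) (ltr_pdivlMr _ _ C0) => /andP[ar aC] na ha.
pose l := dot h a / dot h e.
rewrite (_ : z + a = z + (a - l *: e) + l *: e); last by vec.
have l0 : 0 <= l by rewrite divr_ge0// ltW.
apply: (disc_join (V := dir (carrier z)) (r := r) cH) => //.
- by move=> w wV wr; apply: zH; exact: zr.
- by rewrite /e addrC subrK.
- apply: (mem_carrier_dir_turned nn nN).
    by rewrite dotBr dotZr na ne mulr0 subrr.
  by rewrite dotBr dotZr divfK ?subrr// gt_eqF.
- rewrite (le_lt_trans _ ar)// (le_trans (ler_normB _ _))// /D mulrDr mulr1.
  rewrite lerD2l normrZ ger0_norm// mulrA ler_wpM2r// /l ler_pdivrMr//.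
  rewrite -mulrA divfK ?gt_eqF// mulrC.
  by rewrite (le_trans (ler_norm _))// hC.
- by rewrite ler_pdivrMr//; have := ler_norm (dot h a); have := hC a; lra.
Qed.

Lemma finite_hyperfaces_around : finite_set (hyperfaces_around z).
Proof.
have fin := finite_cells_at z.
apply: (@sub_finite_set _ _ ((fun PQ => PQ.1 `&` PQ.2) @`
    ([set P | T P /\ P z] `*` [set P | T P /\ P z]))); last first.
  by apply: finite_image; exact: finite_setX.
move=> H HH; have [nn nH _] := turning_normal_spec HH.
have [r r0 Hr] := hyperface_ray HH.
move: nn nH Hr; set n := turning_normal _ _ _ _ => nn nH Hr.
have zH := HH.2; have hH := HH.1.
have nN w : w \in dir (carrier z) -> dot n w = 0.
  by move=> /(subvP (dir_mono zH)); exact: (normal_to_dir n H).1.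
set h := turned_back n in Hr.
have hh : dot h h = 1 by exact: turned_back_unit.
have [e e0 ze] := cells_near tilingT z.
have m0 : 0 < Num.min r e by rewrite lt_min r0.
have [k k0] := small_multiple h m0; rewrite lt_min => /andP[kr ke].
set x := z + k *: h.
have xz P : T P -> P x -> P z by apply: ze; rewrite /x addrC addKr.
have Hx : H x.
  apply: Hr => //; first by rewrite dotZr (turned_back_orth n) mulr0.
  by rewrite dotZr hh mulr1.
have zx := carrier_mono xz.
have rkx : (d <= (rk x).+1)%N.
  have hV : h \notin dir (carrier z).
    apply/negP => /(turned_back_normal n); rewrite -/h hh => /eqP.
    by rewrite oner_eq0.
  suff : ((rk z).+1 <= rk x)%N by have := zd; lia.
  rewrite -(dim_addv_line hV); apply: dimvS.
  apply/subvP => y /memv_addP[y1 y1V [_ /vlineP[c ->] ->]].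
  apply: memvD; first exact: (subvP (dir_mono zx)).
  rewrite memvZ// (_ : h = k^-1 *: (x - z)) ?memvZ//.
    by apply: mem_dir => //; exact: zx.
  by rewrite /x addrC addKr scalerA mulVf ?scale1r// gt_eqF.
have [xd HE] := hyperface_carrier tilingT hH Hx rkx.
have [P [Q [u' ts]]] := codim1_two_sided tilingT xd.
exists (P, Q) => /=; last by rewrite HE (ts_carrier ts).
by split; split; [exact: ts_cell1 ts| |exact: ts_cell2 ts|];
  apply: xz; [exact: ts_cell1 ts|exact: ts_mem1 ts|exact: ts_cell2 ts|exact: ts_mem2 ts].
Qed.

End Ray.
End Rays.

(** * Consistent families near points of codimension at most two *)

Section LocalTriviality.
Variables (R : realType) (d : nat) (T : set (set 'rV[R]_d)) (s : set 'rV[R]_d -> R).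
Hypothesis tilingT : locally_finite_normal_tiling T.
Local Notation E := 'rV[R]_d.
Local Notation two_sided := (two_sided T).
Local Notation carrier := (carrier T).
Local Notation rk := (rk T).
Local Notation jump := (jump s).
Local Notation trivial_near := (trivial_near T s).
Local Notation consistent := (consistent T s).
Implicit Types (x y z a b c u v w p q n h e : E) (P Q S F H O K M C : set E) (t : R).

(** At most two cells meet near x, so the zero function on one of them and the
    jump on the other form a consistent family. *)
Lemma trivial_codim1 x : (d <= (rk x).+1)%N -> trivial_near [set x].
Proof.
move=> dx; have [e e0 xe] := cells_near tilingT x; exists e => //.
have near y P : thick [set x] e y -> T P -> P y -> P x.
  by move=> [_ -> yx]; exact: xe.
move: dx; rewrite leq_eqVlt => /orP[/eqP/esym dx|dx]; last first.
  exists (fun=> 0) => y P Q u yx ts; exfalso; apply: (ts_neq tilingT ts).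
  apply: (interior_cell_uniq tilingT (ts_cell1 ts) (ts_cell2 ts)).
    apply: (rk_interior tilingT dx (ts_cell1 ts)).
    exact: near yx (ts_cell1 ts) (ts_mem1 ts).
  exact: near yx (ts_cell2 ts) (ts_mem2 ts).
have [P [Q [u ts]]] := codim1_two_sided tilingT dx.
exists (fun S => if `[< S = Q >] then jump P Q u x else 0) => y P' Q' u' yx ts'.
have P'Q' := ts_neq tilingT ts'; have PQ := ts_neq tilingT ts.
have P'x := near _ _ yx (ts_cell1 ts') (ts_mem1 ts').
have Q'x := near _ _ yx (ts_cell2 ts') (ts_mem2 ts').
have dn := ts_directed_normal tilingT ts'.
have uy : P y -> Q y -> dot u y = dot u x.
  move=> Py Qy; apply/eqP; rewrite -subr_eq0 -dotBr (ts_normal ts)//.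
  by apply: mem_dir => //; rewrite (ts_carrier ts).
have [P'E|P'E] := ts_only ts (ts_cell1 ts') P'x;
  have [Q'E|Q'E] := ts_only ts (ts_cell2 ts') Q'x; subst P' Q' => //.
- have -> := directed_normal_uniq ts dn.
  case: asboolP => // _; case: asboolP => // _.
  by rewrite add0r /jump uy //; [exact: ts_mem1 ts'|exact: ts_mem2 ts'].
- have -> := directed_normal_uniq (two_sidedC ts) dn.
  case: asboolP => // _; case: asboolP => // _.
  rewrite /jump dotNl setIC uy; [|exact: ts_mem2 ts'|exact: ts_mem1 ts'].
  by rewrite scalerN mulrN opprK; apply/esym/eqP; rewrite addrC; apply/eqP; congr pair;
     rewrite /= ?addNr ?addrN ?subrr.
Qed.

Hypothesis canonical_s : canonical_scaling T s.

Section Codim2.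
Variables (z u v : E).
Hypothesis zd : ((rk z).+2 = d)%N.
Hypothesis frame : normal_frame (carrier z) u v.
Local Notation cross := (cross u v).
Local Notation nrm := (turning_normal u v (carrier z)).
Local Notation ray H := (turned_back u v (nrm H)).

Let Hs := fset_set (hyperfaces_around T z).

Let mem_Hs H : H \in Hs <-> hyperfaces_around T z H.
Proof.
rewrite in_fset_set; first by split=> [/set_mem|/mem_set].
exact: (finite_hyperfaces_around tilingT zd frame).
Qed.

(** The weighted normals of the hyperfaces around z that the segment from z + a to
    z + b crosses, with the sign of the crossing. *)
Definition crossing_sum_vec a b : E := \sum_(H <- Hs)
  (crossing (dot (nrm H) a) (dot (nrm H) b) (cross a b) * s H) *: nrm H.

(** The vector a is parallel to no hyperface around z, and its projection to the
    normal plane is nonzero. *)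
Definition generic_vec a := dot u a != 0 /\ forall H, H \in Hs -> dot (nrm H) a != 0.

Let nn H : H \in Hs -> dot (nrm H) (nrm H) = 1.
Proof. by move=> /mem_Hs/(turning_normal_spec tilingT zd frame)[]. Qed.

Let nN H w : H \in Hs -> w \in dir (carrier z) -> dot (nrm H) w = 0.
Proof.
move=> /mem_Hs HH; have [_ zH] := HH.
have [_ nH _] := turning_normal_spec tilingT zd frame HH.
by move=> /(subvP (dir_mono zH)); exact: (normal_to_dir _ H).1.
Qed.

(** The condition Delta = 0 at the face that carries z. *)
Lemma sum_normals : \sum_(H <- Hs) s H *: nrm H = 0.
Proof.
have [_ /(_ (carrier z) u v)] := canonical_s; rewrite /Delta fsbig_finite.
  apply => //; have [P TP Pz] := cell_cover tilingT z.
  exists P, (rk z); split => //; [exact: (carrier_face tilingT)| |by rewrite addn2].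
  by apply/has_dimP; split => //; exists z.
exact: (finite_hyperfaces_around tilingT zd frame).
Qed.

Lemma crossC a b : cross b a = - cross a b.
Proof. by rewrite /cross; ring. Qed.

Lemma crossing_sum_vecC a b : crossing_sum_vec b a = - crossing_sum_vec a b.
Proof.
rewrite /crossing_sum_vec -sumrN; apply: eq_bigr => H _.
by rewrite crossC crossingN mulNr scaleNr.
Qed.

(** All rays are crossed equally often, and the weighted normals add up to
    zero. *)
Lemma crossing_sum_vec_triangle a b c :
  generic_vec a -> generic_vec b -> generic_vec c ->
  cross a b != 0 -> cross b c != 0 -> cross c a != 0 ->
  crossing_sum_vec a b + crossing_sum_vec b c + crossing_sum_vec c a = 0.
Proof.
move=> [_ ga] [_ gb] [_ gc] ab bc ca.
rewrite -!big_split/=.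
transitivity (winding (cross b c) (cross c a) (cross a b) *: \sum_(H <- Hs) s H *: nrm H);
  last by rewrite sum_normals scaler0.
rewrite scaler_sumr; apply: eq_big_seq => H HH.
rewrite -(@crossing_sum _ (dot (nrm H) a) (dot (nrm H) b) (dot (nrm H) c)) //.
- by vec.
- exact: ga.
- exact: gb.
- exact: gc.
have nE := frame_decomp zd frame (fun w => nN (w := w) HH).
by rewrite /cross nE !dotDl !dotZl; ring.
Qed.

(** The coordinates along n have opposite signs at a and b; where they vanish, the
    sign of the cross product decides on which half of the line the point lies. *)
Lemma crossing_point H a b : H \in Hs ->
  crossing (dot (nrm H) a) (dot (nrm H) b) (cross a b) != 0 ->
  exists t, [/\ 0 <= t, t <= 1, dot (nrm H) (pt a b t) = 0 & 0 < dot (ray H) (pt a b t)].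
Proof.
move=> HH; set n := nrm H; set A := dot n a; set B := dot n b; set Z := cross a b.
have ZE : Z = dot (ray H) a * B - A * dot (ray H) b.
  exact: (cross_turned_back zd frame (nn HH) (fun w => nN (w := w) HH)).
move=> cr; have [BA BAZ [t0 t1]] : [/\ B - A != 0, 0 < Z / (B - A) &
    0 <= A / (A - B) /\ A / (A - B) <= 1].
  move: cr; rewrite /crossing; case: ifP => [/and3P[A0 B0 Z0] _|_].
    have BA : 0 < B - A by lra.
    split; [by rewrite gt_eqF|by rewrite divr_gt0|].
    rewrite -opprB invrN mulrN -mulNr; split; first by rewrite divr_ge0; lra.
    by rewrite ler_pdivrMr; lra.
  case: ifP => [/and3P[A0 B0 Z0] _|_]; last by rewrite eqxx.
  have AB : 0 < A - B by lra.
  split; [by rewrite lt_eqF//; lra| |].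
    by rewrite -opprB invrN mulrN -mulNr divr_gt0//; lra.
  split; first by rewrite divr_ge0; lra.
  by rewrite ler_pdivrMr; lra.
have AB : A - B != 0 by rewrite -opprB oppr_eq0.
exists (A / (A - B)); split => //.
  by rewrite /pt dotDr dotZr dotBr -/A -/B; field.
rewrite (_ : dot _ (pt _ _ _) = Z / (B - A))//.
rewrite ZE /pt dotDr dotZr dotBr; field.
by rewrite AB BA.
Qed.

Lemma generic_vec_thin : thin [set p | ~ generic_vec (p - z)].
Proof.
exists ((u, dot u z) :: [seq (nrm H, dot (nrm H) z) | H <- Hs]).
  move=> h; rewrite in_cons => /orP[/eqP ->|/mapP[H HH ->]]; apply: unit_neq0.
    by case: frame => -[].
  exact: nn.
move=> p np; have [up|up] := eqVneq (dot u p) (dot u z).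
  by exists (u, dot u z); rewrite ?mem_head.
suff [H HH Hp] : exists2 H, H \in Hs & dot (nrm H) p = dot (nrm H) z.
  exists (nrm H, dot (nrm H) z) => //; rewrite in_cons; apply/orP; right.
  by apply/mapP; exists H.
apply: contrapT => noH; apply: np; split; first by rewrite dotBr subr_eq0.
move=> H HH; rewrite dotBr subr_eq0; apply/eqP => Hp; apply: noH.
by exists H.
Qed.

Lemma cross_thin a : generic_vec a -> thin [set p | cross a (p - z) = 0].
Proof.
move=> [ua _]; pose m := dot u a *: v - dot v a *: u.
have mE b : cross a b = dot m b by rewrite /cross /m dotBl !dotZl.
have m0 : m != 0.
  apply: contra_neq ua => m0; have : dot m v = 0 by rewrite m0 dot0l.
  case: frame => _ [vv _] uv.
  by rewrite /m dotBl !dotZl vv uv mulr0 subr0 mulr1.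
apply: thinS (thin_hyperplane (dot m z) m0) => p /=.
by rewrite mE dotBr => /eqP; rewrite subr_eq0 => /eqP.
Qed.

Lemma uniform_ray : exists2 r : R, 0 < r & forall H, H \in Hs -> forall a,
  `|a| < r -> dot (nrm H) a = 0 -> 0 < dot (ray H) a -> H (z + a).
Proof.
apply: (@finite_radius R _ [set` Hs] (fun H r => forall a,
    `|a| < r -> dot (nrm H) a = 0 -> 0 < dot (ray H) a -> H (z + a))).
- by [].
- by move=> H e e' ee' He a ae; apply: He; exact: lt_le_trans ee'.
- by move=> H /= /mem_Hs HH; exact: (hyperface_ray tilingT zd frame).
Qed.

Lemma cell_generic P y (U B : set E) : T P -> P y -> open U -> U y -> thin B ->
  exists p, [/\ P^° p, U p & ~ B p].
Proof.
move=> TP Py oU Uy thB.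
have [q Pq Uq] : exists2 q, P^° q & U q.
  by apply: (cell_dense tilingT TP Py); exact: open_nbhs_nbhs.
have [p [Pp Up] Bp] : exists2 p, (P^° `&` U) p & ~ B p.
  apply: (thin_avoid (x := q) thB); apply: filterI; first exact: nbhs_interior.
  exact: open_nbhs_nbhs.
by exists p.
Qed.

Lemma pt_sub a b c t : pt (a - c) (b - c) t = pt a b t - c.
Proof. vec. Qed.

(** A hyperface whose ray is crossed would contain an interior point of P. *)
Lemma crossing_sum_vec_interior r P p q :
  (forall H, H \in Hs -> forall a,
    `|a| < r -> dot (nrm H) a = 0 -> 0 < dot (ray H) a -> H (z + a)) ->
  T P -> P^° p -> P^° q -> `|p - z| < r -> `|q - z| < r ->
  crossing_sum_vec (p - z) (q - z) = 0.
Proof.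
move=> rays TP Pp Pq pr qr; rewrite /crossing_sum_vec big_seq big1// => H HH.
suff -> : crossing (dot (nrm H) (p - z)) (dot (nrm H) (q - z)) (cross (p - z) (q - z)) = 0.
  by rewrite mul0r scale0r.
apply: contrapT => /eqP/(crossing_point HH)[t [t0 t1]]; rewrite pt_sub => nt ht.
have Hx : H (pt p q t).
  rewrite -[pt p q t](subrK z) addrC; apply: rays => //.
  rewrite -pt_sub -[X in `|X|]subr0 -[X in _ - X](_ : pt 0 0 t = 0); last by vec.
  by apply: pt_near; rewrite ?subr0.
have Px : P^° (pt p q t).
  have [->|tN] := eqVneq t 0; first by rewrite pt0.
  apply: segment_interior => //; first exact: (cell_convex tilingT).
    exact: interior_subset.
  by rewrite lt_neqAle eq_sym tN.
have xd := interior_rk tilingT TP Px.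
have [|xd' _] := hyperface_carrier tilingT ((mem_Hs H).1 HH).1 Hx; first by rewrite xd.
by move: xd'; rewrite xd; lia.
Qed.

(** A hyperface whose ray is crossed contains a point of the segment; close to y the
    only hyperface through such a point is P `&` Q, and its ray is crossed from P
    to Q. *)
Lemma crossing_sum_vec_facet (r e : R) y P Q n p q :
  (forall H, H \in Hs -> forall a,
    `|a| < r -> dot (nrm H) a = 0 -> 0 < dot (ray H) a -> H (z + a)) ->
  (forall x, `|x - y| < e -> forall P, T P -> P x -> P y) ->
  two_sided y P Q n -> P z -> Q z -> P p -> Q q ->
  `|p - z| < r -> `|q - z| < r -> `|p - y| < e -> `|q - y| < e ->
  generic_vec (p - z) -> generic_vec (q - z) ->
  0 < dot (ray (P `&` Q)) (p - z) -> 0 < dot (ray (P `&` Q)) (q - z) ->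
  crossing_sum_vec (p - z) (q - z) = s (P `&` Q) *: n.
Proof.
move=> rays ye ts Pz Qz Pp Qq pr qr pe qe [_ gp] [_ gq] hp hq.
have PQH : P `&` Q \in Hs.
  apply/mem_Hs; split; first exact: codim1_hyperface ts.
  by move=> x zx; split; apply: zx => //; [exact: ts_cell1 ts|exact: ts_cell2 ts].
have PQy : (P `&` Q) y by split; [exact: ts_mem1 ts|exact: ts_mem2 ts].
rewrite /crossing_sum_vec (bigD1_seq (P `&` Q)) ?fset_uniq//=.
rewrite [X in _ + X]big_seq_cond [X in _ + X]big1 ?addr0; last first.
  move=> H /andP[HH HN].
  suff -> : crossing (dot (nrm H) (p - z)) (dot (nrm H) (q - z)) (cross (p - z) (q - z)) = 0.
    by rewrite mul0r scale0r.
  apply: contrapT => /eqP/(crossing_point HH)[t [t0 t1]]; rewrite pt_sub => nt ht.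
  set x := pt p q t in nt ht.
  have Hx : H x.
    rewrite -[x](subrK z) addrC; apply: rays => //.
    rewrite -pt_sub -[X in `|X|]subr0 -[X in _ - X](_ : pt 0 0 t = 0); last by vec.
    by apply: pt_near; rewrite ?subr0.
  have xy : forall S, T S -> S x -> S y.
    apply: ye; rewrite -[X in _ - X](_ : pt y y t = y); last by vec.
    exact: pt_near.
  have := rk_mono xy; rewrite -ltnS (ts_rk ts) => dx.
  have [xd HE] := hyperface_carrier tilingT ((mem_Hs H).1 HH).1 Hx dx.
  have PQx : (P `&` Q) x.
    have [P1 [Q1 [u1 ts1]]] := codim1_two_sided tilingT xd.
    have PQ1 := ts_neq tilingT ts1.
    have P1E := ts_only ts (ts_cell1 ts1) (xy _ (ts_cell1 ts1) (ts_mem1 ts1)).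
    have Q1E := ts_only ts (ts_cell2 ts1) (xy _ (ts_cell2 ts1) (ts_mem2 ts1)).
    move: (ts_mem1 ts1) (ts_mem2 ts1).
    by case: P1E PQ1 => ->; case: Q1E => -> // _ ? ?.
  have [_ PQE] := hyperface_carrier tilingT (codim1_hyperface tilingT ts) PQx dx.
  by move: HN; rewrite HE PQE eqxx.
set m := nrm (P `&` Q) in hp hq *.
have [mm mN _] := turning_normal_spec tilingT zd frame ((mem_Hs _).1 PQH).
rewrite -/m in mm mN.
have mz x : dot m (x - z) = dot m (x - y).
  rewrite -[RHS]addr0 -(mN y z PQy (conj Pz Qz)) -dotDr; congr dot; vec.
have cE := cross_turned_back zd frame mm (fun w => nN (w := w) PQH) (p - z) (q - z).
have np := ts_side1 tilingT ts Pp; have nq := ts_side2 tilingT ts Qq.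
have := gp _ PQH; have := gq _ PQH; rewrite -/m => mq0 mp0.
rewrite /crossing; have [mE|mE] := unit_normal_pm ts (conj mm mN).
  have A : dot m (p - z) < 0 by rewrite lt_neqAle mp0 mz mE.
  have B : 0 < dot m (q - z) by rewrite lt_neqAle eq_sym mq0 mz mE.
  have Z : 0 < cross (p - z) (q - z) by rewrite cE; nra.
  by rewrite A B Z/= mul1r mE.
have A : 0 < dot m (p - z) by rewrite lt_neqAle eq_sym mp0 mz mE dotNl oppr_ge0.
have B : dot m (q - z) < 0 by rewrite lt_neqAle mq0 mz mE dotNl oppr_le0.
have Z : cross (p - z) (q - z) < 0 by rewrite cE; nra.
by rewrite A B Z ltNge (ltW A)/= mulN1r mE scalerN scaleNr opprK.
Qed.


(** The gradient on a cell is the sum over the rays between a base point and a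
    point of the cell; crossing one more facet adds the corresponding jump. *)
Lemma trivial_codim2_frame : trivial_near [set z].
Proof.
have [e e0 ze] := cells_near tilingT z.
have [r r0 rays] := uniform_ray.
have re0 : 0 < Num.min r e by rewrite lt_min r0.
have [pw _ /contrapT gw] : exists2 p, setT p & ~ [set p | ~ generic_vec (p - z)] p.
  by apply: (thin_avoid (x := z)); [exact: generic_vec_thin|exact: filterT].
set w := pw - z in gw.
have /choice[f fP] : forall P, exists p, T P -> P z ->
    [/\ P^° p, `|p - z| < r, generic_vec (p - z) & cross w (p - z) != 0].
  move=> P; have [[TP Pz]|nP] := pselect (T P /\ P z); last first.
    by exists 0 => TP Pz; case: nP.
  have [p [Pp [_ -> pr] /not_orP[/contrapT gp /eqP cp]]] :=
    cell_generic TP Pz (@thick_open _ _ [set z] r) (sub_thick r0 (erefl z))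
      (thinU generic_vec_thin (cross_thin gw)).
  by exists p.
pose S P := crossing_sum_vec w (f P - z).
exists (Num.min r e) => //; exists (fun P => (S P, - dot (S P) z)).
move=> y P Q n [_ -> yz] ts.
have [yr ye] : `|y - z| < r /\ `|y - z| < e by move: yz; rewrite lt_min => /andP.
have TP := ts_cell1 ts; have TQ := ts_cell2 ts.
have Py := ts_mem1 ts; have Qy := ts_mem2 ts.
have Pz : P z by apply: ze TP Py.
have Qz : Q z by apply: ze TQ Qy.
have HPQ : hyperfaces_around T z (P `&` Q).
  split; first exact: codim1_hyperface ts.
  by move=> x zx; split; exact: zx.
have hy : 0 < dot (ray (P `&` Q)) (y - z).
  have [_ _ side] := turning_normal_spec tilingT zd frame HPQ.
  apply: side => // zy.
  have : (rk y <= rk z)%N by apply: rk_mono => S' TS' S'z; exact: zy.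
  by have := ts_rk ts; have := zd; lia.
have [e' e'0 ye'] := cells_near tilingT y.
pose U := thick [set y] e' `&` thick [set z] r `&`
  (dot (ray (P `&` Q)) @^-1` [set k | dot (ray (P `&` Q)) z < k]).
have oU : open U.
  apply: openI; first by apply: openI; exact: thick_open.
  by apply: open_comp; [move=> ? _; exact: dot_continuous|exact: open_gt].
have Uy : U y.
  split; first by split; [exact: sub_thick|exists z].
  by move: hy; rewrite dotBr subr_gt0.
have [_ _ gfP cfP] := fP P TP Pz; have [_ _ gfQ cfQ] := fP Q TQ Qz.
have [p [Pp [[[_ -> pe] [_ -> pr]] hp] /not_orP[/not_orP[/contrapT gp /eqP cwp] /eqP cp]]] :=
  cell_generic TP Py oU Uy (thinU (thinU generic_vec_thin (cross_thin gw)) (cross_thin gfP)).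
have [q [Qq [[[_ -> qe] [_ -> qr]] hq]
  /not_orP[/not_orP[/not_orP[/contrapT gq /eqP cwq] /eqP cq] /eqP cpq]]] :=
  cell_generic TQ Qy oU Uy (thinU (thinU (thinU generic_vec_thin (cross_thin gw)) (cross_thin gfQ)) (cross_thin gp)).
have [fPp fPr _ _] := fP P TP Pz; have [fQq fQr _ _] := fP Q TQ Qz.
have cN a b : cross a b != 0 -> cross b a != 0 by rewrite crossC oppr_eq0.
have tri1 := crossing_sum_vec_triangle gw gfP gp cfP cp (cN _ _ cwp).
have tri2 := crossing_sum_vec_triangle gw gfQ gq cfQ cq (cN _ _ cwq).
have tri3 := crossing_sum_vec_triangle gw gp gq cwp cpq (cN _ _ cwq).
rewrite (crossing_sum_vec_interior rays TP fPp Pp fPr pr) addr0 in tri1.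
rewrite (crossing_sum_vec_interior rays TQ fQq Qq fQr qr) addr0 in tri2.
have facet : crossing_sum_vec (p - z) (q - z) = s (P `&` Q) *: n.
  apply: (crossing_sum_vec_facet rays ye' ts) => //; try exact: interior_subset.
    by rewrite dotBr subr_gt0.
  by rewrite dotBr subr_gt0.
have SE : S Q = S P + s (P `&` Q) *: n.
  move: tri1 tri2 tri3; rewrite facet (crossing_sum_vecC w (p - z)) => /eqP.
  rewrite subr_eq0 => /eqP E1 /eqP; rewrite addr_eq0 => /eqP E2 /eqP.
  by rewrite addr_eq0 => /eqP E3; rewrite /S E1 E2 E3.
have nyz : dot n y = dot n z.
  apply/eqP; rewrite -subr_eq0 -dotBr (ts_normal ts)// mem_dir//.
  by rewrite (ts_carrier ts).
rewrite SE /jump dotDl dotZl nyz opprD.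
reflexivity.
Qed.

End Codim2.

Lemma trivial_codim2 x : (d <= (rk x).+2)%N -> trivial_near [set x].
Proof.
rewrite leq_eqVlt => /orP[/eqP/esym xd|]; last exact: trivial_codim1.
have [u uu uN] := @proper_vspace_unit_normal _ _ (dir (carrier x)) ltac:(rewrite -/(rk x); lia).
have uV : u \notin dir (carrier x).
  by apply/negP => /uN; rewrite uu => /eqP; rewrite oner_eq0.
have [v vv vN] : exists2 v, dot v v = 1 & forall w, w \in (dir (carrier x) + <[u]>)%VS -> dot v w = 0.
  by apply: proper_vspace_unit_normal; rewrite dim_addv_line// -/(rk x); lia.
apply: (@trivial_codim2_frame x u v) => //; split.
- by split => //; apply/normal_to_dir.
- split => //; apply/normal_to_dir => w wV; apply: vN.
  exact: subvP (addvSl _ _) _ wV.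
- rewrite dotC; apply: vN; apply: subvP (addvSr _ _) _ (memv_line _).
Qed.

End LocalTriviality.

(** * The global family *)

Section GlobalFamily.
Variables (R : realType) (d : nat) (T : set (set 'rV[R]_d)) (s : set 'rV[R]_d -> R).
Hypothesis tilingT : locally_finite_normal_tiling T.
Hypothesis canonical_s : canonical_scaling T s.
Local Notation E := 'rV[R]_d.
Local Notation two_sided := (two_sided T).
Local Notation rk := (rk T).
Local Notation trivial_near := (trivial_near T s).
Local Notation consistent := (consistent T s).
Implicit Types (x y z u v w p q n : E) (P Q K C : set E) (t : R).
Implicit Types (l : set E -> E * R) (c : E * R).

Variables (P0 : set E) (x0 : E).
Hypotheses (cellP0 : T P0) (P0x0 : P0^° x0).

(** Along such a segment a family can be transported from P0 to the cell of y. *)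
Definition visible y := forall t, 0 <= t -> t <= 1 -> (d <= (rk (pt x0 y t)).+1)%N.

(** Such a triangle carries a consistent family. *)
Definition triangle_generic y y' := forall t r, 0 <= t -> t <= 1 -> 0 <= r -> r <= 1 ->
  (d <= (rk (pt x0 (pt y y' t) r)).+2)%N.

Lemma norm_pt x y t (M : R) : 0 <= t -> t <= 1 -> `|x| <= M -> `|y| <= M -> `|pt x y t| <= M.
Proof.
move=> t0 t1 xM yM; rewrite ptE (le_trans (ler_normD _ _))// !normrZ.
by rewrite !ger0_norm ?subr_ge0//; nra.
Qed.

Lemma thin_invisible (M : R) : `|x0| <= M -> thin [set y | `|y| <= M /\ ~ visible y].
Proof.
move=> x0M; apply: thinS (generic_thin tilingT x0 0 M) => y [yM /existsNP[t]].
move=> /not_implyP[t0 /not_implyP[t1 /negP]]; rewrite -ltnNge => td.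
have tN : t != 0.
  by apply: contraTneq td => ->; rewrite pt0 (interior_rk tilingT cellP0 P0x0); lia.
exists 0, t; rewrite mem0v tN addr0 dimv0; split => //; first exact: norm_pt.
by rewrite -/(pt x0 y t); lia.
Qed.

(** Modulo the line of y - x0, the differences between x0 and the points of the
    triangle are multiples of y' - x0. *)
Lemma thin_triangle y (M : R) : visible y -> `|x0| <= M -> `|y| <= M ->
  thin [set y' | `|y'| <= M /\ ~ triangle_generic y y'].
Proof.
move=> visy x0M yM; apply: thinS (generic_thin tilingT x0 <[y - x0]> M).
move=> y' [y'M /existsNP[t] /existsNP[r]].
move=> /not_implyP[t0 /not_implyP[t1 /not_implyP[r0 /not_implyP[r1 /negP]]]].
rewrite -ltnNge => rd.
have tN : t != 0.
  by apply: contraTneq rd => ->; rewrite pt0; have := visy r r0 r1; lia.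
have rN : r != 0.
  by apply: contraTneq rd => ->; rewrite pt0 (interior_rk tilingT cellP0 P0x0); lia.
exists ((r * (1 - t)) *: (y - x0)), (r * t).
have E1 : x0 + (r * (1 - t)) *: (y - x0) + (r * t) *: (y' - x0) = pt x0 (pt y y' t) r.
  by vec.
rewrite E1 memvZ ?memv_line//; split => //; first by rewrite mulf_neq0.
  by apply: norm_pt => //; exact: norm_pt.
apply: leq_ltn_trans rd; rewrite -addnA -addn2 leq_add2l -(addn1 1) leq_add2r.
by rewrite dim_vline leq_b1.
Qed.

(** The value that a family along the segment from x0 to y, zero on P0, takes
    on the cell of y. *)
Definition segment_value y c := exists2 e : R, 0 < e & exists l,
  [/\ consistent l (thick (seg x0 y 0 1) e), l P0 = 0 &
      forall Q, T Q -> Q^° y -> l Q = c].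

Lemma seg_start x y : seg x y 0 1 x.
Proof. by exists 0; split; rewrite ?pt0. Qed.

Lemma seg_end x y : seg x y 0 1 y.
Proof. by exists 1; split; rewrite ?pt1. Qed.

Lemma segment_value_uniq y c c' Q : T Q -> Q^° y ->
  segment_value y c -> segment_value y c' -> c = c'.
Proof.
move=> TQ Qy [e e0 [l [lC l0 lQ]]] [e' e'0 [l' [l'C l'0 l'Q]]].
pose m := Num.min e e'; have m0 : 0 < m by rewrite lt_min e0.
have : l P0 - l' P0 = l Q - l' Q.
  apply: (@consistent_diff _ _ _ s tilingT l l' (thick (seg x0 y 0 1) m) _ _ x0 y) => //.
  - by apply: thick_convex; exact: seg_convex.
  - exact: thick_open.
  - by apply: consistentS lC; apply: thick_sub; rewrite // ge_min lexx.
  - by apply: consistentS l'C; apply: thick_sub; rewrite // ge_min lexx orbT.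
  - by apply: sub_thick => //; exact: seg_start.
  - by apply: sub_thick => //; exact: seg_end.
by rewrite l0 l'0 (lQ Q)// (l'Q Q)// subrr => /esym/eqP; rewrite subr_eq0 => /eqP.
Qed.

Lemma trivial_normalize K : trivial_near K ->
  exists2 e : R, 0 < e & exists2 l, consistent l (thick K e) & l P0 = 0.
Proof.
move=> [e e0 [l lK]]; exists e => //; exists (fun P => l P - l P0); last by rewrite subrr.
exact: consistent_shift.
Qed.

Lemma segment_value_sub l K e y Q : 0 < e -> consistent l (thick K e) -> l P0 = 0 ->
  seg x0 y 0 1 `<=` K -> T Q -> Q^° y -> segment_value y (l Q).
Proof.
move=> e0 lK l0 yK TQ Qy; exists e => //; exists l; split => //.
  by apply: consistentS lK; exact: thick_sub.
move=> S TS Sy; congr l; apply: (interior_cell_uniq tilingT TS TQ Sy).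
exact: interior_subset.
Qed.

Lemma segment_value_ex y Q : T Q -> Q^° y -> visible y -> exists c, segment_value y c.
Proof.
move=> TQ Qy visy.
have /trivial_normalize[e e0 [l lK l0]] : trivial_near (seg x0 y 0 1).
  apply: (trivial_segment tilingT) => t t0 t1; apply: (trivial_codim1 s tilingT).
  exact: visy.
by exists (l Q); exact: segment_value_sub lK _ _ _ _.
Qed.

Lemma triangle_family y y' : triangle_generic y y' ->
  exists2 e : R, 0 < e & exists2 l, consistent l (thick (tri x0 y y' 0 1) e) & l P0 = 0.
Proof.
move=> gen; apply: trivial_normalize; apply: (trivial_triangle tilingT) => t t0 t1.
apply: (trivial_segment tilingT) => r r0 r1; apply: (trivial_codim2 tilingT canonical_s).
exact: gen.
Qed.

Lemma tri_seg1 x y z : seg x y 0 1 `<=` tri x y z 0 1.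
Proof. by move=> _ [r [r0 r1 ->]]; exists 0, r; rewrite pt0 r0 r1 lexx ler01. Qed.

Lemma tri_seg2 x y z : seg x z 0 1 `<=` tri x y z 0 1.
Proof. by move=> _ [r [r0 r1 ->]]; exists 1, r; rewrite pt1 r0 r1 lexx ler01. Qed.

Lemma tri_seg3 x y z : seg y z 0 1 `<=` tri x y z 0 1.
Proof. by move=> _ [t [t0 t1 ->]]; exists t, 1; rewrite pt1 t0 t1 lexx ler01. Qed.

Lemma same_cell_value y y' Q c c' : T Q -> Q^° y -> Q^° y' -> triangle_generic y y' ->
  segment_value y c -> segment_value y' c' -> c = c'.
Proof.
move=> TQ Qy Qy' /triangle_family[e e0 [l lC l0]] vy vy'.
rewrite (segment_value_uniq TQ Qy vy (segment_value_sub e0 lC l0 (@tri_seg1 _ _ _) TQ Qy)).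
by rewrite (segment_value_uniq TQ Qy' vy' (segment_value_sub e0 lC l0 (@tri_seg2 _ _ _) TQ Qy')).
Qed.

(** The family of the triangle and the family around x differ by a constant along
    the segment from y to y', so both jump alike between P and Q. *)
Lemma adjacent_value x P Q u y y' c c' e : two_sided x P Q u ->
  (exists l, consistent l (thick [set x] e)) ->
  P^° y -> Q^° y' -> `|y - x| < e / 2 -> `|y' - x| < e / 2 -> triangle_generic y y' ->
  segment_value y c -> segment_value y' c' -> c' = c + jump s P Q u x.
Proof.
move=> ts [l' l'C] Py Qy' ye y'e /triangle_family[e' e'0 [l lC l0]] vy vy'.
have TP := ts_cell1 ts; have TQ := ts_cell2 ts.
rewrite (segment_value_uniq TP Py vy (segment_value_sub e'0 lC l0 (@tri_seg1 _ _ _) TP Py)).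
rewrite (segment_value_uniq TQ Qy' vy' (segment_value_sub e'0 lC l0 (@tri_seg2 _ _ _) TQ Qy')).
have e0 : 0 < e by have := normr_ge0 (y - x); lra.
pose m := Num.min e' (e / 2); have m0 : 0 < m by rewrite lt_min e'0 divr_gt0.
have : l P - l' P = l Q - l' Q.
  apply: (@consistent_diff _ _ _ s tilingT l l' (thick (seg y y' 0 1) m) _ _ y y') => //.
  - by apply: thick_convex; exact: seg_convex.
  - exact: thick_open.
  - apply: consistentS lC; apply: thick_sub; last by rewrite ge_min lexx.
    exact: tri_seg3.
  - apply: consistentS l'C => z [_ [t [t0 t1 ->]] zt]; exists x => //.
    rewrite (_ : z - x = (z - pt y y' t) + (pt y y' t - pt x x t)); last by vec.
    rewrite (le_lt_trans (ler_normD _ _))//.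
    have : `|pt y y' t - pt x x t| < e / 2 by exact: pt_near.
    have me : m <= e / 2 by rewrite ge_min lexx orbT.
    lra.
  - by apply: sub_thick => //; exact: seg_start.
  - by apply: sub_thick => //; exact: seg_end.
have xx : thick [set x] e x by exact: sub_thick.
rewrite (l'C x P Q u xx ts) => E1.
by rewrite -[l Q](subrK (l' P + jump s P Q u x)) -E1 addrA subrK.
Qed.


(** Each cell gets the value at a chosen generic point.  For generic points y of P
    and y' of Q near a point x of their facet, triangles with apex x0 connect y
    and y' to the chosen points of P and Q, and to each other. *)
Lemma global_family : exists2 l, consistent l setT & l P0 = 0.
Proof.
have x0M : forall a : R, 0 <= a -> `|x0| <= `|x0| + a by move=> a a0; rewrite lerDl.
have ball_open x e : 0 < e -> open (thick [set x] e) /\ thick [set x] e x.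
  by move=> e0; split; [exact: thick_open|exact: sub_thick].
have /choice[f fP] : forall Q, exists yc : E * (E * R), T Q ->
    [/\ Q^° yc.1, visible yc.1 & segment_value yc.1 yc.2].
  move=> Q; have [TQ|] := pselect (T Q); last by exists (0, 0).
  have [q Qq] := cell_interior tilingT TQ.
  pose M := `|x0| + (`|q| + 1).
  have MM : `|x0| <= M by rewrite x0M// addr_ge0.
  have [op qp] := ball_open q 1 ltr01.
  have [y [Qy [_ -> yq] vis]] := cell_generic tilingT TQ (interior_subset Qq) op qp (thin_invisible MM).
  have visy : visible y.
    apply: contrapT => nv; apply: vis; split => //.
    rewrite -[y](subrK q) (le_trans (ler_normD _ _))// /M.
    by have := normr_ge0 x0; lra.
  have [c vc] := segment_value_ex TQ Qy visy.
  by exists (y, c) => _; split.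
exists (fun Q => (f Q).2); last first.
  have [Py visy vc] := fP P0 cellP0.
  apply: (segment_value_uniq cellP0 Py vc).
  have [c [e e0 [l [lC l0 lc]]]] := segment_value_ex cellP0 Py visy.
  by exists e => //; exists l; split => // Q TQ Qy;
    rewrite (interior_cell_uniq tilingT TQ cellP0 Qy (interior_subset Py)).
move=> x P Q u _ ts; have TP := ts_cell1 ts; have TQ := ts_cell2 ts.
have [Pf visf vf] := fP P TP; have [Qg visg vg] := fP Q TQ.
set yP := (f P).1 in Pf visf vf; set yQ := (f Q).1 in Qg visg vg.
have [e e0 [l lx]] : trivial_near [set x].
  by apply: trivial_codim1 => //; rewrite (ts_rk ts).
pose M := `|x0| + (`|x| + (e + (`|yP| + `|yQ|))).
have e2 : 0 < e / 2 by exact: divr_gt0.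
have [op xp] := ball_open x _ e2.
have MM : `|x0| <= M by rewrite x0M// !addr_ge0// ltW.
have PM : `|yP| <= M.
  by rewrite /M; have := normr_ge0 x0; have := normr_ge0 x; have := normr_ge0 yQ; lra.
have QM : `|yQ| <= M.
  by rewrite /M; have := normr_ge0 x0; have := normr_ge0 x; have := normr_ge0 yP; lra.
have inM y : `|y - x| < e / 2 -> `|y| <= M.
  move=> yx; rewrite -[y](subrK x) (le_trans (ler_normD _ _))// /M.
  by have := normr_ge0 x0; have := normr_ge0 yQ; have := normr_ge0 yP; lra.
have [y [Py [_ -> yx] /not_orP[yv yt]]] := cell_generic tilingT TP (ts_mem1 ts) op xp
  (thinU (thin_invisible MM) (thin_triangle visf MM PM)).
have visy : visible y by apply: contrapT => nv; apply: yv; split => //; exact: inM.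
have triy : triangle_generic yP y.
  by apply: contrapT => nv; apply: yt; split => //; exact: inM.
have [y' [Qy' [_ -> y'x] /not_orP[/not_orP[y'v y't] yy't]]] :=
  cell_generic tilingT TQ (ts_mem2 ts) op xp
  (thinU (thinU (thin_invisible MM) (thin_triangle visg MM QM)) (thin_triangle visy MM (inM _ yx))).
have visy' : visible y' by apply: contrapT => nv; apply: y'v; split => //; exact: inM.
have triy' : triangle_generic yQ y'.
  by apply: contrapT => nv; apply: y't; split => //; exact: inM.
have triyy' : triangle_generic y y'.
  by apply: contrapT => nv; apply: yy't; split => //; exact: inM.
have [c vc] := segment_value_ex TP Py visy.
have [c' vc'] := segment_value_ex TQ Qy' visy'.
rewrite (same_cell_value TP Pf Py triy vf vc) (same_cell_value TQ Qg Qy' triy' vg vc').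
by apply: adjacent_value ts _ Py Qy' yx y'x triyy' vc vc'; exists l.
Qed.

End GlobalFamily.

(** * The maximum of the affine functions *)

Section ConvexFunction.
Variables (R : realType) (d : nat) (T : set (set 'rV[R]_d)) (s : set 'rV[R]_d -> R).
Hypothesis tilingT : locally_finite_normal_tiling T.
Hypothesis scaling_s : scaling T s.
Local Notation E := 'rV[R]_d.
Local Notation two_sided := (two_sided T).
Local Notation rk := (rk T).
Implicit Types (x y z u v w p q n : E) (P Q K C : set E) (t : R).
Variable l : set E -> E * R.
Hypothesis consistent_l : consistent T s l setT.

Lemma affine_value_pt (f : E * R) x y t :
  affine_value f (pt x y t) = (1 - t) * affine_value f x + t * affine_value f y.
Proof. by rewrite /affine_value ptE dotDr !dotZr; ring. Qed.

Lemma values_agree x P Q : T P -> T Q -> P x -> Q x ->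
  affine_value (l P) x = affine_value (l Q) x.
Proof.
move=> TP TQ Px Qx; have [e e0 xe] := cells_near tilingT x.
have oO := @thick_open _ _ [set x] e.
have Ox : thick [set x] e x by exact: sub_thick.
have [p Pp Op] := cell_dense tilingT TP Px (open_nbhs_nbhs (conj oO Ox)).
have [q Qq Oq] := cell_dense tilingT TQ Qx (open_nbhs_nbhs (conj oO Ox)).
apply: (@cells_connected _ _ _ tilingT
  (fun P Q => affine_value (l P) x = affine_value (l Q) x) (thick [set x] e) P Q p q) => //.
- by move=> P1 P2 P3 ->.
- apply: thick_convex; apply/is_convexP => y z t _ -> ->.
  by rewrite /= /pt subrr scaler0 addr0.
move=> y P' Q' u [_ -> yx] ts; rewrite (consistent_l I ts) affine_valueD jump_value.
rewrite (ts_normal ts) ?mulr0 ?addr0//; apply: mem_dir => //.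
rewrite (ts_carrier ts); split.
  by apply: xe (ts_cell1 ts) (ts_mem1 ts).
by apply: xe (ts_cell2 ts) (ts_mem2 ts).
Qed.

(** Along a generic segment towards x each crossing of a facet replaces the
    affine function by one with a larger value at x. *)
Lemma value_max_interior x P Q : T P -> T Q -> Q^° x ->
  affine_value (l P) x <= affine_value (l Q) x.
Proof.
move=> TP TQ Qx; have [p0 Pp0] := cell_interior tilingT TP.
pose M := `|x| + (`|p0| + 1).
have oU := @thick_open _ _ [set p0] 1.
have Up : thick [set p0] 1 p0 by exact: sub_thick.
have [p [Pp [_ -> pp0] gen]] := cell_generic tilingT TP (interior_subset Pp0) oU Up
  (generic_thin tilingT x 0 M).
have xM : `|x| <= M by rewrite lerDl addr_ge0.
have pM : `|p| <= M.
  rewrite -[p](subrK p0) (le_trans (ler_normD _ _))// /M.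
  by have := normr_ge0 x; lra.
apply: (@walk _ _ _ tilingT
  (fun P Q => affine_value (l P) x <= affine_value (l Q) x) p x P Q) => //.
- by move=> P1 P2 P3; exact: le_trans.
- move=> t t0 t1; have [->|tN] := eqVneq t 1.
    by rewrite pt1 (interior_rk tilingT TQ Qx) leqnSn.
  have E1 : x + 0 + (1 - t) *: (p - x) = pt p x t by vec.
  rewrite leqNgt; apply/negP => td; apply: gen; exists 0, (1 - t).
  rewrite E1 mem0v subr_eq0 eq_sym tN dimv0; split => //; first exact: norm_pt.
  by rewrite addn0 addn1.
- move=> t P' Q' u t0 t1 ts ux.
  rewrite (consistent_l I ts) affine_valueD jump_value lerDl.
  rewrite mulr_ge0//; first by rewrite ltW//; apply: scaling_s; exact: codim1_hyperface ts.
  rewrite (_ : x - pt p x t = (1 - t) *: (x - p)); last by vec.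
  by rewrite dotZr mulr_ge0// subr_ge0.
- exact: interior_subset.
- exact: interior_subset.
Qed.

(** The inequality holds at the points of Q close to x in the interior of Q, and
    both sides are affine on a segment that ends at x. *)
Lemma value_max x P Q : T P -> T Q -> Q x ->
  affine_value (l P) x <= affine_value (l Q) x.
Proof.
move=> TP TQ Qx; have [c Qc] := cell_interior tilingT TQ.
set A := affine_value (l Q) x - affine_value (l P) x.
set B := affine_value (l Q) c - affine_value (l P) c.
have AB t : 0 < t -> t <= 1 -> 0 <= (1 - t) * A + t * B.
  move=> t0 t1; have := @value_max_interior (pt x c t) P Q TP TQ
    (segment_interior (cell_convex tilingT TQ) Qx Qc t0 t1).
  by rewrite !affine_value_pt /A /B; lra.
rewrite -subr_ge0 -/A leNgt; apply/negP => A0.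
have B0 : 0 <= B by have := AB 1 ltr01 (lexx _); lra.
have D0 : 0 < B - A by lra.
have D1 : 0 < 2 * (B - A) by lra.
have := AB (- A / (2 * (B - A))).
have tE : - A / (2 * (B - A)) * (B - A) = - A / 2 by field; lra.
rewrite divr_gt0// ?oppr_gt0// ler_pdivrMr// => /(_ isT).
have -> : - A <= 1 * (2 * (B - A)) by lra.
move=> /(_ isT); rewrite [X in 0 <= X](_ : _ = A + - A / (2 * (B - A)) * (B - A)); last by ring.
by rewrite tE; lra.
Qed.

Definition cell_of x : set E := xget set0 [set P | T P /\ P x].

Lemma cell_ofP x : T (cell_of x) /\ cell_of x x.
Proof.
have [P TP Px] := cell_cover tilingT x.
exact: (@xgetPex _ set0 [set P | T P /\ P x] (ex_intro _ P (conj TP Px))).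
Qed.

Definition pl_function x : R := affine_value (l (cell_of x)) x.

Local Notation G := pl_function.

Lemma pl_functionE x P : T P -> P x -> G x = affine_value (l P) x.
Proof. by have [TC Cx] := cell_ofP x; move=> TP Px; exact: values_agree. Qed.

Lemma pl_function_ge x P : T P -> affine_value (l P) x <= G x.
Proof. by have [TC Cx] := cell_ofP x; move=> TP; exact: value_max. Qed.

Lemma pl_function_pt x y t : 0 <= t -> t <= 1 -> G (pt x y t) <= (1 - t) * G x + t * G y.
Proof.
move=> t0 t1; have [TC _] := cell_ofP (pt x y t).
rewrite {1}/G affine_value_pt; apply: lerD; apply: ler_wpM2l => //.
- by rewrite subr_ge0.
- exact: pl_function_ge.
- exact: pl_function_ge.
Qed.

Lemma pl_function_convex : is_convex_function G.
Proof.
move=> t x y _ _.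
have H : G (pt y x t%:num) <= t%:num * G x + (1 - t%:num) * G y.
  by rewrite addrC; exact: pl_function_pt (ge0 t) (le1 t).
by rewrite ptE addrC in H; exact: H.
Qed.

Lemma pl_function_near x (e : R) : 0 < e -> exists2 r : R, 0 < r &
  forall w, `|w| < r -> `|G (x + w) - G x| < e.
Proof.
move=> e0; have [r r0 xr] := cells_near tilingT x.
have [P r1 r2 r21 H w wr|P [TP Px]|r' r'0 Hr] := @finite_radius R _ _ (fun P r => forall w, `|w| < r ->
    `|affine_value (l P) (x + w) - affine_value (l P) x| < e) (finite_cells_at tilingT x).
- by apply: H; exact: lt_le_trans r21.
- have [C C0 hC] := dot_bound (l P).1; exists (e / C); first exact: divr_gt0.
  move=> w; rewrite ltr_pdivlMr// => we.
  rewrite (_ : _ - _ = dot (l P).1 w); last by rewrite /affine_value dotDr; ring.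
  by rewrite (le_lt_trans (hC _))// mulrC.
exists (Num.min r r'); first by rewrite lt_min r0.
move=> w; rewrite lt_min => /andP[wr wr'].
have [P TP Pw] := cell_cover tilingT (x + w).
have Px : P x by apply: xr TP Pw; rewrite addrC addKr.
by rewrite (pl_functionE TP Pw) (pl_functionE TP Px); apply: Hr.
Qed.

Lemma pl_function_continuous : continuous G.
Proof.
move=> x A /nbhs_ballP[e e0 eA]; have [r r0 xr] := pl_function_near x e0.
change (nbhs x (G @^-1` A)); apply/nbhs_shiftP; exists r => // w /xr wr.
by apply: eA; rewrite /ball/= distrC.
Qed.

Lemma pl_function_piecewise : piecewise_linear_on T G.
Proof.
by move=> P TP; exists (l P).1, (l P).2 => x Px; rewrite (pl_functionE TP Px).
Qed.

End ConvexFunction.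

(** * Lifts and chains *)

Lemma hull_image (R : realType) n m (phi : 'rV[R]_n -> 'rV[R]_m) (s : seq 'rV[R]_n) :
  (forall x y t, phi (pt x y t) = pt (phi x) (phi y) t) ->
  phi @` convex_hull [set` s] = convex_hull [set` map phi s].
Proof.
move=> aff; apply/seteqP; split.
  suff : convex_hull [set` s] `<=` phi @^-1` convex_hull [set` map phi s].
    by move=> sub _ [x /sub ? <-].
  apply: hull_min.
    apply/is_convexP => x y t /andP[t0 t1] hx hy /=; rewrite aff.
    by apply: pt_conv => //; exact: hull_convex.
  by move=> x xs /=; apply: sub_hull; exact: map_f.
apply: hull_min.
  apply/is_convexP => _ _ t /andP[t0 t1] [x hx <-] [y hy <-].
  by exists (pt x y t); rewrite ?aff//; apply: pt_conv => //; exact: hull_convex.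
by move=> _ /= /mapP[x xs ->]; exists x => //; exact: sub_hull.
Qed.

Section LiftAlgebra.
Variables (R : realType) (d : nat).
Local Notation E := 'rV[R]_d.
Local Notation E1 := 'rV[R]_(d + 1).
Implicit Types (x y a : E) (z : E1) (t r : R) (P Q F : set E) (f : E * R).

Definition height z : R := rsubmx z 0 0.

Lemma lift_pt_eta z : z = lift_pt (orth_proj z) (height z).
Proof.
rewrite -[LHS]hsubmxK; congr row_mx; apply/matrixP => i j.
by rewrite !ord1 [RHS]mxE eqxx mulr1n.
Qed.

Lemma orth_proj_lift x t : orth_proj (lift_pt x t) = x.
Proof. exact: row_mxKl. Qed.

Lemma height_lift x t : height (lift_pt x t) = t.
Proof. by rewrite /height row_mxKr mxE eqxx mulr1n. Qed.

Lemma lift_ptD x t y r : lift_pt x t + lift_pt y r = lift_pt (x + y) (t + r).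
Proof. by rewrite /lift_pt add_row_mx raddfD. Qed.

Lemma lift_ptZ k x t : k *: lift_pt x t = lift_pt (k *: x) (k * t).
Proof. by rewrite /lift_pt scale_row_mx scale_scalar_mx. Qed.

Lemma lift_ptB x t y r : lift_pt x t - lift_pt y r = lift_pt (x - y) (t - r).
Proof. by rewrite -scaleN1r lift_ptZ lift_ptD scaleN1r mulN1r. Qed.

Lemma dot_lift a t x r : dot (lift_pt a t) (lift_pt x r) = dot a x + t * r.
Proof.
rewrite /dot big_split_ord big_ord1; congr (_ + _).
  by apply: eq_bigr => i _; rewrite !row_mxEl.
by rewrite !row_mxEr !mxE !eqxx !mulr1n.
Qed.

Lemma pt_lift x t y r k : pt (lift_pt x t) (lift_pt y r) k = lift_pt (pt x y k) (t + k * (r - t)).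
Proof. by rewrite /pt lift_ptB lift_ptZ lift_ptD. Qed.

(** The part over Q of the graph of the affine function f. *)
Definition lift_over f Q : set E1 := [set lift_pt x (affine_value f x) | x in Q].

Lemma mem_lift_over f Q x t : lift_over f Q (lift_pt x t) <-> Q x /\ t = affine_value f x.
Proof.
split=> [[y Qy yx]|[Qx ->]]; last by exists x.
have /(congr1 (@orth_proj _ _)) := yx; rewrite !orth_proj_lift => yE.
have /(congr1 height) := yx; rewrite !height_lift => <-.
by rewrite -yE.
Qed.

Lemma lift_over_proj f Q : @orth_proj R d @` lift_over f Q = Q.
Proof.
apply/seteqP; split=> [_ [_ [x Qx <-] <-]|x Qx]; first by rewrite orth_proj_lift.
by exists (lift_pt x (affine_value f x)); rewrite ?orth_proj_lift//; exists x.
Qed.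

Lemma lift_over_polytope f Q : polytope Q -> polytope (lift_over f Q).
Proof.
move=> [s ->]; eexists; apply: (@hull_image _ _ _ (fun x => lift_pt x (affine_value f x))).
move=> x y t; rewrite pt_lift affine_value_pt; congr lift_pt; ring.
Qed.

Definition lift_dir a x : E1 := lift_pt x (dot a x).

Lemma lift_dir_linear a : linear (lift_dir a).
Proof. by move=> k x y; rewrite /lift_dir dotDr dotZr -lift_ptD lift_ptZ. Qed.

HB.instance Definition _ a := GRing.isLinear.Build R E E1 *:%R (lift_dir a) (lift_dir_linear a).

(** The linear part of the parametrization maps the direction of Q, which is the
    whole space, onto the direction of the lift. *)
Lemma lift_over_direction f Q : has_dim Q d ->
  is_direction (lift_over f Q) (limg (linfun (lift_dir f.1))).
Proof.
move=> /has_dimP[[x0 Qx0] Qd]; split.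
  move=> _ _ [x Qx <-] [y Qy <-]; rewrite lift_ptB.
  rewrite (_ : lift_pt _ _ = linfun (lift_dir f.1) (x - y)) ?memv_img ?memvf//.
  rewrite lfunE/= /lift_dir /affine_value; congr lift_pt.
  by rewrite dotBr; ring.
move=> W QW; apply/subvP => _ /memv_imgP[x _ ->].
suff : (dir Q <= linfun (lift_dir f.1) @^-1: W)%VS.
  by move=> /subvP/(_ x (mem_dim_full _ Qd)); rewrite -memv_preim.
apply: (dir_min Qx0) => y Qy; rewrite -memv_preim lfunE/=.
rewrite (_ : lift_dir _ _ = lift_pt y (affine_value f y) - lift_pt x0 (affine_value f x0)).
  by apply: QW; [exists y|exists x0].
by rewrite lift_ptB /lift_dir dotBr /affine_value; congr lift_pt; ring.
Qed.

Lemma lift_over_is_lift f Q : polytope Q -> has_dim Q d -> is_lift Q (lift_over f Q).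
Proof.
move=> pQ Qd; have dirQ := lift_over_direction f Qd; split.
- exact: lift_over_polytope.
- split.
    by have [[x Qx] _] := Qd; exists (lift_pt x (affine_value f x)), x.
  exists (limg (linfun (lift_dir f.1))) => //.
  rewrite limg_dim_eq ?dim_rV//.
  apply/eqP; rewrite -subv0; apply/subvP => x; rewrite memv_cap memv_ker lfunE/= memv0.
  move=> /andP[_ /eqP/(congr1 (@orth_proj _ _))]; rewrite orth_proj_lift => ->.
  by apply/eqP/rowP => i; rewrite !mxE.
- move=> V /dir_uniq ->; rewrite -(dir_uniq dirQ); apply/negP => /memv_imgP[x _].
  rewrite lfunE/= => n0E.
  have /(congr1 (@orth_proj _ _)) := n0E; rewrite !orth_proj_lift => x0.
  have /(congr1 height) := n0E; rewrite !height_lift -x0 dot0r => /eqP.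
  by rewrite oppr_eq0 oner_eq0.
- exact: lift_over_proj.
Qed.

Lemma lift_over_face f F Q : is_face F Q -> is_face (lift_over f F) (lift_over f Q).
Proof.
move=> [a [b [Qa ->]]]; exists (lift_pt a 0), b; split.
  by move=> _ [x Qx <-]; rewrite dot_lift mul0r addr0 Qa.
apply/seteqP; split=> z.
  move=> [x [Qx /= xb] <-]; split; first by exists x.
  by rewrite /= dot_lift mul0r addr0.
by move=> [[x Qx <-] /=]; rewrite dot_lift mul0r addr0 => xb; exists x.
Qed.

Lemma lift_overI f g P Q : (forall x, P x -> Q x -> affine_value f x = affine_value g x) ->
  lift_over f P `&` lift_over g Q = lift_over f (P `&` Q).
Proof.
move=> fg; apply/seteqP; split=> z.
  move=> [[x Px <-] /mem_lift_over[Qx xE]]; exists x => //.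
move=> [x [Px Qx] <-]; split; first by exists x.
by rewrite (fg x Px Qx); exists x.
Qed.

End LiftAlgebra.

Section Chains.
Variables (R : realType) (d : nat) (T : set (set 'rV[R]_d)) (s : set 'rV[R]_d -> R).
Hypothesis tilingT : locally_finite_normal_tiling T.
Local Notation E := 'rV[R]_d.
Local Notation two_sided := (two_sided T).
Variables (P0 : set E) (l : set E -> E * R).
Hypotheses (cellP0 : T P0) (consistent_l : consistent T s l setT) (l0 : l P0 = 0).
Implicit Types (x y z u v w p q n : E) (P Q K C : set E) (t : R) (Qt : set 'rV[R]_(d + 1)).

Lemma cell_polytope P : T P -> polytope P.
Proof. by case: tilingT => -[+ _ _ _ _] => /[apply] -[]. Qed.

Lemma cell_dim P : T P -> has_dim P d.
Proof. by case: tilingT => -[+ _ _ _ _] => /[apply] -[]. Qed.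

Lemma normal_step x P Q u : two_sided x P Q u ->
  lift_pt (l P).1 (-1) + embed (s (P `&` Q) *: u) = lift_pt (l Q).1 (-1).
Proof. by move=> ts; rewrite (consistent_l I ts) lift_ptD addr0. Qed.

(** A lift is determined by its normal vector and one of its points. *)
Lemma lift_up_uniq x P Q u Qt : two_sided x P Q u ->
  is_lift_up P Q (lift_over (l P) P) (lift_pt (l P).1 (-1)) (s (P `&` Q) *: u) Qt ->
  Qt = lift_over (l Q) Q.
Proof.
move=> ts [[_ _ _ projQ]]; rewrite (normal_step ts) => nQ _ _ projPQ.
have : (P `&` Q) x by split; [exact: ts_mem1 ts|exact: ts_mem2 ts].
rewrite -projPQ => -[_ [[p Pp <-] Qtp] _].
have : (P `&` Q) p.
  rewrite -projPQ; exists (lift_pt p (affine_value (l P) p)); rewrite ?orth_proj_lift//.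
  by split => //; exists p.
move=> [_ Qp].
rewrite (values_agree tilingT consistent_l (ts_cell1 ts) (ts_cell2 ts) Pp Qp) in Qtp.
have heightE (z : 'rV[R]_(d + 1)) : Qt z -> z = lift_pt (orth_proj z) (affine_value (l Q) (orth_proj z)).
  move=> Qtz; rewrite {1}[z]lift_pt_eta; congr lift_pt.
  have := nQ _ _ Qtz Qtp; rewrite {1}[z]lift_pt_eta lift_ptB dot_lift dotBr /affine_value.
  by lra.
apply/seteqP; split=> z.
  move=> /[dup] Qtz /heightE ->; exists (orth_proj z) => //.
  by rewrite -projQ; exists z.
move=> [y + <-]; rewrite -{1}projQ => -[z' Qtz' <-].
by rewrite -(heightE _ Qtz').
Qed.

Lemma chain_lift_over c Qt nt : chain_lift T s P0 c Qt nt ->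
  forall c' Q, c = rcons c' Q ->
    [/\ T Q, Qt = lift_over (l Q) Q & nt = lift_pt (l Q).1 (-1)].
Proof.
elim=> [c' Q|{}c P Q Pt {}nt u {}Qt _ IH TQ adj dn lift c' Q'].
  rewrite -[[:: P0]]/(rcons [::] P0) => /rcons_inj[_ <-]; split => //; last by rewrite l0.
  by congr (_ @` P0); apply/funext => x; rewrite l0 /affine_value dot0l addr0.
move=> /rcons_inj[_ <-]; have [TP PtE ntE] := IH _ _ erefl.
have [x [u' ts]] := adjacent_two_sided tilingT TP TQ adj.
have uE := directed_normal_uniq ts dn; subst Pt nt u.
split => //; first exact: lift_up_uniq ts lift.
exact: normal_step ts.
Qed.

Lemma lift_over_step x P Q u : two_sided x P Q u ->
  is_lift_up P Q (lift_over (l P) P) (lift_pt (l P).1 (-1)) (s (P `&` Q) *: u)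
    (lift_over (l Q) Q).
Proof.
move=> ts; have TP := ts_cell1 ts; have TQ := ts_cell2 ts.
have agree := values_agree tilingT consistent_l TP TQ.
have [fP fQ] := cells_meet_face tilingT TP TQ (ts_mem1 ts) (ts_mem2 ts).
split.
- by apply: lift_over_is_lift; [exact: cell_polytope|exact: cell_dim].
- rewrite (normal_step ts) => _ _ [y Qy <-] [y' Qy' <-].
  by rewrite lift_ptB dot_lift dotBr /affine_value; ring.
- by rewrite (lift_overI agree); exact: lift_over_face.
- rewrite setIC lift_overI; last by move=> y Qy Py; rewrite agree.
  by rewrite setIC; exact: lift_over_face.
- by rewrite (lift_overI agree) lift_over_proj.
Qed.

(** Reachability is inherited across facets, and facets connect all cells. *)
Lemma chain_exists Q : T Q -> exists c,
  chain_lift T s P0 (rcons c Q) (lift_over (l Q) Q) (lift_pt (l Q).1 (-1)).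
Proof.
move=> TQ; pose reach Q := exists c,
  chain_lift T s P0 (rcons c Q) (lift_over (l Q) Q) (lift_pt (l Q).1 (-1)).
have [p0 Pp0] := cell_interior tilingT cellP0.
have [q Qq] := cell_interior tilingT TQ.
apply: (@cells_connected _ _ _ tilingT (fun P Q => reach P -> reach Q) setT P0 Q p0 q) => //.
- by move=> P1 P2 P3 H1 H2 /H1 /H2.
- exact: openT.
- move=> x P Q' u _ ts [c cP]; exists (rcons c P); rewrite -(normal_step ts).
  apply: (chain_lift_step cP) => //; first exact: ts_cell2 ts.
  - exact: ts_adjacent ts.
  - exact: ts_directed_normal ts.
  - exact: lift_over_step ts.
exists [::]; rewrite l0 /=.
rewrite (_ : lift_over _ _ = @embed R d @` P0); first exact: chain_lift_init.
by congr (_ @` P0); apply/funext => x; rewrite /affine_value dot0l addr0.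
Qed.

Lemma chain_nonempty c Qt nt : chain_lift T s P0 c Qt nt -> exists c' Q, c = rcons c' Q.
Proof. by case=> [|c' P Q *]; [exists [::], P0|exists (rcons c' P), Q]. Qed.

Lemma generatrix_graph : generatrix T s P0 = graph (pl_function T l).
Proof.
apply/seteqP; split=> z.
  move=> [Qt [c [nt chain]]]; have [c' [Q cE]] := chain_nonempty chain.
  have [TQ -> _] := chain_lift_over chain cE.
  move=> [x Qx <-]; exists x => //.
  by rewrite (pl_functionE tilingT consistent_l TQ Qx).
move=> [x _ <-]; have [Q TQ Qx] := cell_cover tilingT x.
have [c chain] := chain_exists TQ.
exists (lift_over (l Q) Q); first by exists (rcons c Q), (lift_pt (l Q).1 (-1)).
by exists x => //; rewrite (pl_functionE tilingT consistent_l TQ Qx).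
Qed.

End Chains.

(** * The epigraph *)

Section Epigraph.
Variables (R : realType) (d : nat) (T : set (set 'rV[R]_d)) (s : set 'rV[R]_d -> R).
Hypothesis tilingT : locally_finite_normal_tiling T.
Hypothesis scaling_s : scaling T s.
Local Notation E := 'rV[R]_d.
Local Notation E1 := 'rV[R]_(d + 1).
Variable l : set E -> E * R.
Hypothesis consistent_l : consistent T s l setT.
Local Notation G := (pl_function T l).
Implicit Types (x : E) (z w : E1).

Definition epigraph : set E1 := [set z | G (orth_proj z) <= height z].

Lemma orth_projD z w : orth_proj (z + w) = orth_proj z + orth_proj w.
Proof. by rewrite [z]lift_pt_eta [w]lift_pt_eta lift_ptD !orth_proj_lift. Qed.

Lemma heightD z w : height (z + w) = height z + height w.
Proof. by rewrite [z]lift_pt_eta [w]lift_pt_eta lift_ptD !height_lift. Qed.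

Lemma orth_proj_norm z : `|orth_proj z| <= `|z|.
Proof.
rewrite [leLHS]mx_normrE; apply: bigmax_le => // -[i j] _ /=.
by rewrite mxE (ord1 i) coord_le_norm.
Qed.

Lemma height_norm z : `|height z| <= `|z|.
Proof. by rewrite /height mxE coord_le_norm. Qed.

Lemma above_near z (e : R) : 0 < e -> exists2 r : R, 0 < r & forall w, `|w| < r ->
  `|(G (orth_proj (z + w)) - height (z + w)) - (G (orth_proj z) - height z)| < e.
Proof.
move=> e0; have e2 : 0 < e / 2 by exact: divr_gt0.
have [r r0 zr] := pl_function_near tilingT consistent_l (orth_proj z) e2.
exists (Num.min r (e / 2)); first by rewrite lt_min r0.
move=> w; rewrite lt_min => /andP[wr we]; rewrite orth_projD heightD.
have := zr (orth_proj w) (le_lt_trans (orth_proj_norm w) wr).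
have := le_lt_trans (height_norm w) we.
rewrite !ltr_norml => /andP[h1 h2] /andP[g1 g2].
by apply/andP; split; lra.
Qed.

Lemma epigraph_interior z : epigraph^° z <-> G (orth_proj z) < height z.
Proof.
split=> [/nbhs_shiftP[e e0 ze]|zG].
  have [k k0 ke] := small_multiple (lift_pt (0 : E) (-1)) e0.
  have := ze _ ke; rewrite /epigraph/= orth_projD heightD lift_ptZ orth_proj_lift height_lift.
  by rewrite scaler0 addr0; lra.
have [|r r0 zr] := above_near z (_ : 0 < height z - G (orth_proj z)).
  by rewrite subr_gt0.
apply/nbhs_shiftP; exists r => // w /zr; rewrite ltr_norml => /andP[_].
by rewrite /epigraph/=; lra.
Qed.

Lemma epigraph_closed : closed epigraph.
Proof.
rewrite -[epigraph]setCK; apply: open_closedC; rewrite openE => z /= /negP.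
rewrite -ltNge => zG; have [|r r0 zr] := above_near z (_ : 0 < G (orth_proj z) - height z).
  by rewrite subr_gt0.
apply/nbhs_shiftP; exists r => // w /zr; rewrite ltr_norml => /andP[+ _] /=.
by move=> wG; apply/negP; rewrite -ltNge; lra.
Qed.

Lemma epigraph_convex : is_convex epigraph.
Proof.
apply/is_convexP => z z' t /andP[t0 t1]; rewrite /epigraph/= => zG z'G.
rewrite [z]lift_pt_eta [z']lift_pt_eta pt_lift orth_proj_lift height_lift.
apply: le_trans (pl_function_pt tilingT scaling_s consistent_l _ _ t0 t1) _.
by nra.
Qed.

(** Near a point only the cells through its projection matter, because the
    function is the maximum of the affine functions of the cells. *)
Lemma epigraph_polyhedron : convex_polyhedron epigraph.
Proof.
split; [exact: epigraph_convex|exact: epigraph_closed|move=> z].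
have /finite_seqP[cs csE] := finite_cells_at tilingT (orth_proj z).
have [r r0 zr] := cells_near tilingT (orth_proj z).
exists [seq (lift_pt (l P).1 (-1), - (l P).2) | P <- cs].
apply/nbhs_shiftP; exists r => // w wr; set y := z + w.
have yE P : (dot (lift_pt (l P).1 (-1)) y <= - (l P).2) =
    (affine_value (l P) (orth_proj y) <= height y).
  rewrite {1}[y]lift_pt_eta dot_lift /affine_value -subr_ge0 -[in RHS]subr_ge0.
  by congr (0 <= _); ring.
split=> [yG h /mapP[P Pcs ->]|yh] /=.
  have : [set` cs] P by [].
  rewrite -csE yE => -[TP _]; apply: le_trans yG.
  exact: (pl_function_ge tilingT scaling_s consistent_l).
have [P TP Py] := cell_cover tilingT (orth_proj y).
rewrite /epigraph/= (pl_functionE tilingT consistent_l TP Py) -yE.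
apply: (yh (lift_pt (l P).1 (-1), - (l P).2)); apply/mapP; exists P => //.
suff : [set` cs] P by [].
rewrite -csE; split => //; apply: zr TP Py.
by rewrite /y orth_projD addrC addKr (le_lt_trans (orth_proj_norm w)).
Qed.

Lemma epigraph_dim : has_dim epigraph (d + 1).
Proof.
have int : epigraph^° (lift_pt 0 (G 0 + 1)).
  by apply/epigraph_interior; rewrite orth_proj_lift height_lift ltrDl.
apply/has_dimP; split; first by eexists; exact: interior_subset int.
by apply: interior_full_dim; eexists; exact: int.
Qed.

Lemma epigraph_boundary : boundary epigraph = graph G.
Proof.
rewrite /boundary -(closure_id _).1; last exact: epigraph_closed.
apply/seteqP; split=> z.
  move=> [zG /epigraph_interior/negP]; rewrite -leNgt => Gz.
  exists (orth_proj z) => //; rewrite [RHS]lift_pt_eta; congr lift_pt.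
  by apply/eqP; rewrite eq_le zG.
move=> [x _ <-]; split; first by rewrite /epigraph/= orth_proj_lift height_lift.
by move=> /epigraph_interior; rewrite orth_proj_lift height_lift ltxx.
Qed.

End Epigraph.

Theorem mainTheorem3 (R : realType) (d : nat)
    (T : set (set 'rV[R]_d)) (s : set 'rV[R]_d -> R) (P0 : set 'rV[R]_d)
    (tilingT : locally_finite_normal_tiling T)
    (canonical_s : canonical_scaling T s)
    (cellP0 : T P0) :
  (exists G : 'rV[R]_d -> R,
     [/\ is_convex_function G, continuous G, piecewise_linear_on T G &
         generatrix T s P0 = graph G]) /\
  (exists K : set 'rV[R]_(d + 1),
     [/\ convex_polyhedron K, has_dim K (d + 1) &
         generatrix T s P0 = boundary K]).
Proof.
have [x0 P0x0] := cell_interior tilingT cellP0.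
have [l consistent_l l0] := global_family tilingT canonical_s cellP0 P0x0.
have scaling_s : scaling T s by case: canonical_s.
have genE := generatrix_graph tilingT cellP0 consistent_l l0.
split.
  exists (pl_function T l); split => //.
  - exact: pl_function_convex consistent_l.
  - exact: pl_function_continuous consistent_l.
  - exact: pl_function_piecewise consistent_l.
exists (epigraph T l); split.
- exact: epigraph_polyhedron consistent_l.
- exact: epigraph_dim consistent_l.
- by rewrite (epigraph_boundary tilingT consistent_l).
Qed.
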